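(* There exists a constant $C>0$ such that $$\|[\lambda_b,S]\|_{L^2(w)\to L^2(w)}\le C\,[w]_{A_2^d}\,\|b\|_{BMO^d}$$ for all $b\in BMO^d$ and all $w\in A_2^d$.
   Context: $\mathcal{D}$ is the collection of dyadic intervals $[k2^{-j},(k+1)2^{-j})$, $j,k\in\mathbb{Z}$, of $\mathbb{R}$. For $I\in\mathcal{D}$, $I_-$ and $I_+$ are its left and right halves, $h_I=|I|^{-1/2}(\chi_{I_+}-\chi_{I_-})$ is the Haar function, $\langle f\rangle_I=\frac{1}{|I|}\int_I f$, and $\langle f,g\rangle=\int_{\mathbb{R}}fg\,dx$. A weight is a locally integrable, a.e. positive function $w$ on $\mathbb{R}$; $\|f\|_{L^2(w)}^2=\int|f|^2w\,dx$; $w\in A_2^d$ means $[w]_{A_2^d}:=\sup_{I\in\mathcal{D}}\langle w\rangle_I\langle w^{-1}\rangle_I<\infty$. $BMO^d$ is the space of locally integrable $b$ with $\|b\|_{BMO^d}:=\sup_{I\in\mathcal{D}}\frac1{|I|}\int_I|b-\langle b\rangle_I|\,dx<\infty$. The dyadic shift operator is $Sf=\sum_{I\in\mathcal{D}}\langle f,h_I\rangle(h_{I_-}-h_{I_+})$, and $\lambda_bf=\sum_{I\in\mathcal{D}}\langle b\rangle_I\langle f,h_I\rangle h_I$. The commutator is $[\lambda_b,S]f=\lambda_b(Sf)-S(\lambda_bf)$, defined on finite linear combinations of Haar functions (dense in $L^2(w)$) and extended by boundedness. *)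

(* Defs.v *)
From HB Require Import structures.
From mathcomp Require Import all_boot all_order all_algebra.
From mathcomp Require Import all_classical all_reals all_analysis.

Set Implicit Arguments.
Unset Strict Implicit.
Unset Printing Implicit Defensive.

Import Order.TTheory GRing.Theory Num.Theory.
Import numFieldNormedType.Exports.

Local Open Scope classical_set_scope.
Local Open Scope ring_scope.

(* The pair (j, k) stands for the interval [k 2^-j, (k+1) 2^-j); this is a
   bijection from pairs of integers onto the dyadic intervals of the line. *)
Definition dyadic : Type := (int * int)%type.

(* In these coordinates the two halves of [k 2^-j, (k+1) 2^-j) are
   [2k 2^-(j+1), (2k+1) 2^-(j+1)) and [(2k+1) 2^-(j+1), (2k+2) 2^-(j+1)). *)
Definition lhalf (I : dyadic) : dyadic := (I.1 + 1, 2 * I.2).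
Definition rhalf (I : dyadic) : dyadic := (I.1 + 1, 2 * I.2 + 1).

Section dyadic_analysis.
Context {R : realType}.
Implicit Types (f g b w : R -> R) (I : dyadic) (A T : (R -> R) -> (R -> R)).

Definition dlen I : R := 2 ^ (- I.1).

Definition dset I : set R := `[I.2%:~R * dlen I, (I.2 + 1)%:~R * dlen I[.

Definition haar I (x : R) : R :=
  (Num.sqrt (dlen I))^-1 * (\1_(dset (rhalf I)) x - \1_(dset (lhalf I)) x).

Definition eavg f I : \bar R :=
  ((dlen I)^-1%R%:E * \int[lebesgue_measure]_(x in dset I) (f x)%:E)%E.

(* Only meaningful for f integrable on I: fine sends infinities to 0. *)
Definition avg f I : R := fine (eavg f I).

Definition pairing f g : R := \int[lebesgue_measure]_x (f x * g x).

Definition bmo_norm b : \bar R :=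
  ereal_sup [set eavg (fun x => `|b x - avg b I|) I | I in [set: dyadic]].

Definition BMOd b : Prop :=
  locally_integrable [set: R] b /\ (bmo_norm b < +oo)%E.

Definition weight w : Prop :=
  locally_integrable [set: R] w /\ {ae lebesgue_measure, forall x, 0 < w x}.

Definition A2_char w : \bar R :=
  ereal_sup [set (eavg w I * eavg (fun x => (w x)^-1)%R I)%E
            | I in [set: dyadic]].

Definition A2d w : Prop := weight w /\ (A2_char w < +oo)%E.

Definition L2norm w f : \bar R :=
  sqrte (\int[lebesgue_measure]_x (`|f x| ^+ 2 * w x)%R%:E)%E.

Definition L2 w f : Prop :=
  measurable_fun [set: R] f /\ (L2norm w f < +oo)%E.

Definition opnorm w T : \bar R :=
  ereal_sup [set L2norm w (T f) | f in [set f | L2 w f /\ (L2norm w f <= 1)%E]].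

Definition haar_comb f : Prop :=
  exists (s : seq dyadic) (c : dyadic -> R),
    f = fun x => \sum_(I <- s) c I * haar I x.

(* The sums over all dyadic intervals below are finitely supported sums. They
   are only used for f a finite linear combination of Haar functions, in which
   case at most finitely many coefficients <f, h_I> are nonzero. *)
Definition dshift f : R -> R := fun x =>
  \sum_(I \in [set: dyadic])
    pairing f (haar I) * (haar (lhalf I) x - haar (rhalf I) x).

Definition lambda b f : R -> R := fun x =>
  \sum_(I \in [set: dyadic]) avg b I * pairing f (haar I) * haar I x.

Definition commutator b f : R -> R := fun x =>
  lambda b (dshift f) x - dshift (lambda b f) x.

(* T is a bounded linear operator on L^2(w), equalities of functions being
   almost everywhere, which extends the operator A given on finite linear
   combinations of Haar functions. As these are dense in L^2(w) for w in A_2,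
   such a T is unique up to almost everywhere equality. *)
Definition bounded_extension w A T : Prop :=
  [/\ forall f, L2 w f -> L2 w (T f),
      forall (a : R) f g, L2 w f -> L2 w g ->
        {ae lebesgue_measure, forall x,
          T (fun y => a * f y + g y) x = a * T f x + T g x},
      (opnorm w T < +oo)%E
    & forall f, haar_comb f ->
        {ae lebesgue_measure, forall x, T f x = A f x}].

End dyadic_analysis.

(* Main.v *)
Require Import Defs.
From HB Require Import structures.
From mathcomp Require Import all_boot all_order all_algebra.
From mathcomp Require Import all_classical all_reals all_analysis.
From mathcomp Require Import measurable_realfun ring lra zify.

(* Since <b>_(I-) - <b>_I = - (<b>_(I+) - <b>_I) is bounded by 2 ||b||_BMO, the
   commutator maps h_I to a combination of h_(I-) and h_(I+) with coefficients
   of size O(||b||_BMO); so it suffices to bound such a shift by C [w]_A2.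

   Finite sums are tested against g = lam h w, where h is the sum itself. With
   v = 1/w and D_I f = (<f>_(I+) - <f>_(I-)) / 2, the resulting bilinear form is
   at most sum_I |I| |D_I f| (|D_(I-) g| + |D_(I+) g|) up to a constant. On a
   finite dyadic tree it is controlled by one explicit Bellman function [bell],
   which compresses sparse domination: stop when <|f|> or <|g|> exceeds four
   times its value A, B at the last stopping interval. Between stops the form is
   estimated by the orthogonality of the D_I, which gives O(AB |Q|); with s, t
   the weighted averages of |f|/v and |g|/w at the stop, AB <= [w] s t and
   2 s t <= s^2 v + t^2 w (as v w = 1). For a = <|f|> and F = <f^2 w>, the
   polynomial 4 F - 4 s a + 2 s^2 <v> is affine along the tree, minimal at the
   reset value s = a / <v>, and at least s^2 <v>; hence it sums s^2 v over all
   stopping intervals without any loss.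

   The bound is uniform in the choice of bounded coefficients, in particular in
   signs, and this forces the partial sums to be Cauchy in L^2(w) for every f in
   L^2(w); no density of Haar functions is needed. The limit is T f. *)

Set Implicit Arguments.
Unset Strict Implicit.
Unset Printing Implicit Defensive.

Import Order.TTheory GRing.Theory Num.Theory.
Import numFieldNormedType.Exports.

Local Open Scope classical_set_scope.
Local Open Scope ring_scope.

(** * A Bellman function on the dyadic tree *)

Fixpoint subtree n (I : dyadic) : seq dyadic :=
  if n is m.+1 then I :: subtree m (lhalf I) ++ subtree m (rhalf I) else [::].

Section bellman.
Context {R : realFieldType}.
Implicit Types (X : dyadic -> R) (I : dyadic).

Definition martingale X := forall I, X (lhalf I) + X (rhalf I) = 2 * X I.

(** For [X = avg f] this is the Haar coefficient of f divided by the square root of |I|, by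
    [pairing_haar]. *)
Definition hdiff X I : R := (X (rhalf I) - X (lhalf I)) / 2.

(** A term at J carries the weight |J|/|I|, which keeps lengths out of the tree estimate;
    [sum_subtree] restores them. *)
Fixpoint energy (t : dyadic -> R) n I : R :=
  if n is m.+1 then t I + (energy t m (lhalf I) + energy t m (rhalf I)) / 2
  else 0.

Lemma martingale_children X I : martingale X ->
  X (lhalf I) = X I - hdiff X I /\ X (rhalf I) = X I + hdiff X I.
Proof. by move=> /(_ I) mX; rewrite /hdiff; split; lra. Qed.

Lemma hdiff_le X Y I : martingale Y -> (forall J, `|X J| <= Y J) ->
  `|hdiff X I| <= Y I.
Proof.
move=> /(_ I) mY XY; have := XY (lhalf I); have := XY (rhalf I).
rewrite /hdiff !ler_norml => /andP[? ?] /andP[? ?].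
by apply/andP; split; lra.
Qed.

Lemma martingale0 X I : martingale X -> (forall J, 0 <= X J) -> X I = 0 ->
  X (lhalf I) = 0 /\ X (rhalf I) = 0.
Proof.
move=> /(_ I) mX X0 XI; have := X0 (lhalf I); have := X0 (rhalf I).
by split; lra.
Qed.

(** Covers the degenerate intervals where the average of |f| or |g| is 0 and cannot serve as a new A
    or B. *)
Lemma energy0 t X n I : martingale X -> (forall J, 0 <= X J) ->
  (forall J, X J = 0 -> t J = 0) -> X I = 0 -> energy t n I = 0.
Proof.
move=> mX X0 Xt; elim: n I => //= n IH I XI.
have [Xl Xr] := martingale0 mX X0 XI.
by rewrite Xt// !IH// addr0 mul0r addr0.
Qed.

(** Balanced so that both summands have size A B when x is of order A and y of order B. *)
Lemma ler_mul_scaled (A B x y : R) : 0 < A -> 0 < B ->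
  2 * (x * y) <= (B / A) * x ^+ 2 + (A / B) * y ^+ 2.
Proof.
move=> A0 B0; rewrite -subr_ge0.
suff -> : B / A * x ^+ 2 + A / B * y ^+ 2 - 2 * (x * y) =
    (A * B)^-1 * (B * x - A * y) ^+ 2.
  by rewrite mulr_ge0 ?sqr_ge0// invr_ge0 mulr_ge0// ltW.
by field; rewrite !gt_eqF.
Qed.

Lemma ler_scaled_sq (A B x : R) : 0 < A -> 0 < B -> `|x| <= 8 * A ->
  (B / A) * x ^+ 2 <= 64 * (A * B).
Proof.
move=> A0 B0 xA; have -> : 64 * (A * B) = B / A * (8 * A) ^+ 2.
  by field; rewrite gt_eqF.
rewrite ler_wpM2l//; first by rewrite divr_ge0// ltW.
by rewrite -(real_normK (num_real x)) lerXn2r ?nnegrE// (le_trans _ xA).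
Qed.

(** * Bellman estimate of the bilinear form on a tree *)

Section tree.
(** In the application f, a, F, v are the averages of f, |f|, f^2 w, 1/w, and g, b, G, u those of g,
    |g|, g^2/w, w; W is the A_2 characteristic. *)
Variables (W : R) (f a F v g b G u : dyadic -> R).
Hypotheses (mf : martingale f) (ma : martingale a) (mF : martingale F)
  (mv : martingale v) (mg : martingale g) (mb : martingale b)
  (mG : martingale G) (mu : martingale u).
Hypotheses (fa : forall I, `|f I| <= a I) (gb : forall I, `|g I| <= b I).
Hypotheses (v0 : forall I, 0 < v I) (u0 : forall I, 0 < u I).
Hypotheses (aF : forall I, a I ^+ 2 <= F I * v I)
  (bG : forall I, b I ^+ 2 <= G I * u I).
Hypotheses (uv1 : forall I, 1 <= u I * v I) (uvW : forall I, u I * v I <= W).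

Definition shift_term I : R :=
  `|hdiff f I| * (`|hdiff g (lhalf I)| + `|hdiff g (rhalf I)|).

(* A and B are the averages of |f| and |g| over the last stopping interval,
   s and t the averages of |f|/v and |g|/u there with respect to v and u. *)
Definition bell A B s t I : R :=
  192 * W * ((4 * F I - 4 * s * a I + 2 * s ^+ 2 * v I) +
             (4 * G I - 4 * t * b I + 2 * t ^+ 2 * u I)) +
  96 * (B * a I + A * b I - 2 * (A * B)) -
  (B / A) * f I ^+ 2 - (A / B) * g I ^+ 2.

Let a0 I : 0 <= a I. Proof. exact: le_trans (fa I). Qed.
Let b0 I : 0 <= b I. Proof. exact: le_trans (gb I). Qed.
Let W1 : 1 <= W. Proof. exact: le_trans (uv1 (0, 0)) (uvW (0, 0)). Qed.

(** Times v', the difference of the sides is at least (2 a' - s v')^2, because F' v' >= a'^2. *)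
Lemma doob_ge (a' F' v' s : R) : 0 < v' -> a' ^+ 2 <= F' * v' ->
  s ^+ 2 * v' <= 4 * F' - 4 * s * a' + 2 * s ^+ 2 * v'.
Proof.
move=> v'0 aF'; rewrite -(ler_pM2r v'0) -subr_ge0.
have := sqr_ge0 (2 * a' - s * v').
by nra.
Qed.

(** The right side is a quadratic in s with minimum at s = a' / v', so resetting s at a stop costs
    nothing. *)
Lemma doob_reset (a' F' v' s : R) : 0 < v' ->
  4 * F' - 4 * (a' / v') * a' + 2 * (a' / v') ^+ 2 * v' <=
  4 * F' - 4 * s * a' + 2 * s ^+ 2 * v'.
Proof.
move=> v'0; rewrite -subr_ge0.
have -> : 4 * F' - 4 * s * a' + 2 * s ^+ 2 * v' -
    (4 * F' - 4 * (a' / v') * a' + 2 * (a' / v') ^+ 2 * v') =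
    2 * (v'^-1 * (s * v' - a') ^+ 2) by field; rewrite gt_eqF.
by rewrite mulr_ge0// mulr_ge0 ?sqr_ge0// invr_ge0 ltW.
Qed.

(** In units of A B the first summand gives at least 384, the middle one at least -192, and each
    subtracted square takes at most 64; this leaves 64. *)
Lemma bell_leaf A B s t I : 0 < A -> 0 < B -> 0 <= s -> 0 <= t ->
  A * B <= W * (s * t) -> a I <= 8 * A -> b I <= 8 * B ->
  64 * (A * B) <= bell A B s t I.
Proof.
move=> A0 B0 s0 t0 AB aA bB.
have f2 := ler_scaled_sq A0 B0 (le_trans (fa I) aA).
have g2 := ler_scaled_sq B0 A0 (le_trans (gb I) bB).
have F2 := doob_ge s (v0 I) (aF I).
have G2 := doob_ge t (u0 I) (bG I).
(* After multiplication by v this is (s v - t)^2 >= 0 together with u v >= 1. *)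
have st : 2 * (s * t) <= s ^+ 2 * v I + t ^+ 2 * u I.
  rewrite -(ler_pM2r (v0 I)); have := sqr_ge0 (s * v I - t).
  have : 0 <= t ^+ 2 * (u I * v I - 1) by rewrite mulr_ge0 ?sqr_ge0// subr_ge0.
  by nra.
have : 2 * (A * B) <=
    W * ((4 * F I - 4 * s * a I + 2 * s ^+ 2 * v I) +
         (4 * G I - 4 * t * b I + 2 * t ^+ 2 * u I)).
  apply: le_trans (_ : W * (2 * (s * t)) <= _); first by lra.
  by rewrite ler_wpM2l ?(le_trans _ W1)//; lra.
have : 0 <= B * a I by rewrite mulr_ge0// ltW.
have : 0 <= A * b I by rewrite mulr_ge0// ltW.
by rewrite /bell; lra.
Qed.

(** With A = a and B = b the middle summand of [bell] vanishes, and the squares are subtracted. *)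
Lemma bell_start I : 0 < a I -> 0 < b I ->
  bell (a I) (b I) (a I / v I) (b I / u I) I <=
  192 * W * ((4 * F I - 4 * (a I / v I) * a I + 2 * (a I / v I) ^+ 2 * v I) +
             (4 * G I - 4 * (b I / u I) * b I + 2 * (b I / u I) ^+ 2 * u I)).
Proof.
move=> aI bI; rewrite /bell.
have : 0 <= b I / a I * f I ^+ 2 by rewrite mulr_ge0 ?sqr_ge0// divr_ge0.
have : 0 <= a I / b I * g I ^+ 2 by rewrite mulr_ge0 ?sqr_ge0// divr_ge0.
by lra.
Qed.

Lemma bell_start_ge0 s t I :
  0 <= 192 * W * ((4 * F I - 4 * s * a I + 2 * s ^+ 2 * v I) +
                  (4 * G I - 4 * t * b I + 2 * t ^+ 2 * u I)).
Proof.
apply: mulr_ge0.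
  exact: mulr_ge0 (ler0n _ _) (le_trans ler01 W1).
apply: addr_ge0.
- by apply: le_trans (doob_ge s (v0 I) (aF I)); rewrite mulr_ge0 ?sqr_ge0// ltW.
- by apply: le_trans (doob_ge t (u0 I) (bG I)); rewrite mulr_ge0 ?sqr_ge0// ltW.
Qed.

(** Past a threshold B a + A b >= 4 A B, so the middle summand is at least 192 A B: it pays 64 A B
    for each square and leaves 64 A B for the parent of I. *)
Lemma bell_stop A B s t I : 0 < A -> 0 < B ->
  a I <= 8 * A -> b I <= 8 * B -> (4 * A < a I) || (4 * B < b I) ->
  192 * W * ((4 * F I - 4 * (a I / v I) * a I + 2 * (a I / v I) ^+ 2 * v I) +
             (4 * G I - 4 * (b I / u I) * b I + 2 * (b I / u I) ^+ 2 * u I)) +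
  64 * (A * B) <= bell A B s t I.
Proof.
move=> A0 B0 aA bB stop; rewrite /bell.
have f2 := ler_scaled_sq A0 B0 (le_trans (fa I) aA).
have g2 := ler_scaled_sq B0 A0 (le_trans (gb I) bB).
have := doob_reset (a I) (F I) s (v0 I).
have := doob_reset (b I) (G I) t (u0 I).
have : 4 * (A * B) <= B * a I + A * b I.
  have Ba : 0 <= B * a I by rewrite mulr_ge0// ltW.
  have Ab : 0 <= A * b I by rewrite mulr_ge0// ltW.
  case/orP: stop => /ltW stop.
  - by have := ler_wpM2l (ltW B0) stop; lra.
  - by have := ler_wpM2l (ltW A0) stop; lra.
set P1 := 4 * F I - _ + _; set Q1 := 4 * G I - _ + _.
set P2 := 4 * F I - _ + _; set Q2 := 4 * G I - _ + _.
move=> AB PP QQ.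
have : W * (P1 + Q1) <= W * (P2 + Q2).
  by rewrite ler_wpM2l ?(le_trans _ W1)//; lra.
by lra.
Qed.

(** Apart from the two squares [bell] is affine in the martingales; a squared martingale at I is the
    mean of its squares at the halves minus [hdiff] squared. *)
Lemma bell_concave A B s t I : 0 < A -> 0 < B ->
  bell A B s t I =
  (bell A B s t (lhalf I) + bell A B s t (rhalf I)) / 2 +
  (B / A) * hdiff f I ^+ 2 + (A / B) * hdiff g I ^+ 2.
Proof.
move=> A0 B0; rewrite /bell.
have [-> ->] := martingale_children I mf.
have [-> ->] := martingale_children I ma.
have [-> ->] := martingale_children I mF.
have [-> ->] := martingale_children I mv.
have [-> ->] := martingale_children I mg.
have [-> ->] := martingale_children I mb.
have [-> ->] := martingale_children I mG.
have [-> ->] := martingale_children I mu.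
by field; rewrite !gt_eqF.
Qed.

Let termb0 I : b I = 0 -> shift_term I = 0.
Proof.
move=> bI; have [bl br] := martingale0 mb b0 bI.
have := hdiff_le (lhalf I) mb gb; rewrite bl normr_le0 => /eqP gl.
have := hdiff_le (rhalf I) mb gb; rewrite br normr_le0 => /eqP gr.
by rewrite /shift_term gl gr normr0 addr0 mulr0.
Qed.

Let terma0 I : a I = 0 -> shift_term I = 0.
Proof.
move=> aI; have := hdiff_le I ma fa; rewrite aI normr_le0 => /eqP fI.
by rewrite /shift_term fI normr0 mul0r.
Qed.

Let FG0 I : 0 <= F I /\ 0 <= G I.
Proof.
split.
- by rewrite -(pmulr_lge0 _ (v0 I)) (le_trans _ (aF I))// sqr_ge0.
- by rewrite -(pmulr_lge0 _ (u0 I)) (le_trans _ (bG I))// sqr_ge0.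
Qed.

(* The term (A / B) (hdiff g I)^2 pays for the parent of I, whose contribution
   to the energy involves hdiff g I. *)
Lemma energy_bell n : forall (A B s t : R) I,
  0 < A -> 0 < B -> 0 <= s -> 0 <= t -> A * B <= W * (s * t) ->
  a I <= 8 * A -> b I <= 8 * B ->
  energy shift_term n I + (A / B) * hdiff g I ^+ 2 <= bell A B s t I.
Proof.
elim: n => [|n IH] A B s t I A0 B0 s0 t0 AB aA bB.
  have gI := ler_scaled_sq B0 A0 (le_trans (hdiff_le I mb gb) bB).
  by have := bell_leaf A0 B0 s0 t0 AB aA bB; rewrite /=; lra.
(* Without a stop at I: a nonnegative martingale at most doubles in one step, so the bound 4 at I
   becomes 8 at the halves. The gain in f pays one half of each product, the terms in g reserved at
   the halves pay the other. *)
have step (A' B' s' t' : R) : 0 < A' -> 0 < B' -> 0 <= s' -> 0 <= t' ->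
    A' * B' <= W * (s' * t') -> a I <= 4 * A' -> b I <= 4 * B' ->
    energy shift_term n.+1 I + (A' / B') * hdiff g I ^+ 2 <= bell A' B' s' t' I.
  move=> A'0 B'0 s'0 t'0 AB' aA' bB'; rewrite bell_concave//.
  have := b0 (lhalf I); have := b0 (rhalf I).
  have := a0 (lhalf I); have := a0 (rhalf I).
  have := ma I; have := mb I => mbI maI al ar bl br.
  have := IH A' B' s' t' (lhalf I) A'0 B'0 s'0 t'0 AB' ltac:(lra) ltac:(lra).
  have := IH A' B' s' t' (rhalf I) A'0 B'0 s'0 t'0 AB' ltac:(lra) ltac:(lra).
  have := ler_mul_scaled `|hdiff f I| `|hdiff g (lhalf I)| A'0 B'0.
  have := ler_mul_scaled `|hdiff f I| `|hdiff g (rhalf I)| A'0 B'0.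
  rewrite !real_normK ?num_real//= /shift_term mulrDr.
  by lra.
have [/orP stop|] := boolP ((4 * A < a I) || (4 * B < b I)); last first.
  by rewrite negb_or -!leNgt => /andP[? ?]; exact: step.
have stopI := bell_stop s t A0 B0 aA bB (introT orP stop).
have gI := ler_scaled_sq B0 A0 (le_trans (hdiff_le I mb gb) bB).
(* The reserve 64 A B pays the parent with the old A and B; the tree below I then starts afresh from
   the averages at I. *)
apply: le_trans stopI; apply: lerD; last by rewrite [A * B]mulrC.
have [aI0|aI0] := eqVneq (a I) 0; last have [bI0|bI0] := eqVneq (b I) 0.
- by rewrite (energy0 _ ma)//; exact: bell_start_ge0.
- by rewrite (energy0 _ mb)//; exact: bell_start_ge0.
have aI : 0 < a I by rewrite lt_neqAle eq_sym aI0 a0.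
have bI : 0 < b I by rewrite lt_neqAle eq_sym bI0 b0.
apply: le_trans (bell_start aI bI).
apply: le_trans (step _ _ _ _ aI bI _ _ _ _ _).
- by rewrite lerDl mulr_ge0 ?sqr_ge0// divr_ge0.
- by rewrite divr_ge0// ltW.
- by rewrite divr_ge0// ltW.
(* Here u v <= W gives A B <= W s t for the new values. *)
- have -> : W * (a I / v I * (b I / u I)) =
      a I * b I * (W / (u I * v I)) by field; rewrite !gt_eqF.
  rewrite ler_peMr ?mulr_ge0// ler_pdivlMr ?mul1r//.
  by rewrite mulr_gt0.
- by lra.
- by lra.
Qed.

(** The root is treated as a stop. The reset values of s and t do no worse than s = t = 0, which
    leaves 4 F + 4 G, and 192 * 4 = 768. *)
Lemma energy_le n I : energy shift_term n I <= 768 * W * (F I + G I).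
Proof.
have W0 : 0 <= W := le_trans ler01 W1.
have [F0 G0] := FG0 I.
have E0 : 0 <= 768 * W * (F I + G I).
  exact: mulr_ge0 (mulr_ge0 (ler0n _ _) W0) (addr_ge0 F0 G0).
have [aI0|aI0] := eqVneq (a I) 0; first by rewrite (energy0 _ ma).
have [bI0|bI0] := eqVneq (b I) 0; first by rewrite (energy0 _ mb).
have aI : 0 < a I by rewrite lt_neqAle eq_sym aI0 a0.
have bI : 0 < b I by rewrite lt_neqAle eq_sym bI0 b0.
have AB : a I * b I <= W * (a I / v I * (b I / u I)).
  have -> : W * (a I / v I * (b I / u I)) =
      a I * b I * (W / (u I * v I)) by field; rewrite !gt_eqF.
  by rewrite ler_peMr ?mulr_ge0// ler_pdivlMr ?mul1r// mulr_gt0.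
have := @energy_bell n (a I) (b I) (a I / v I) (b I / u I) I aI bI
  (divr_ge0 (a0 I) (ltW (v0 I))) (divr_ge0 (b0 I) (ltW (u0 I))) AB
  ltac:(lra) ltac:(lra).
have := bell_start aI bI.
have : 0 <= (a I / b I) * hdiff g I ^+ 2.
  by rewrite mulr_ge0 ?sqr_ge0// divr_ge0.
have := doob_reset (a I) (F I) 0 (v0 I).
have := doob_reset (b I) (G I) 0 (u0 I).
rewrite !mulr0 !mul0r !subr0 expr0n /= !mulr0 !mul0r !addr0.
set P := 4 * F I - _ + _; set Q := 4 * G I - _ + _ => QG PF.
have : W * (P + Q) <= W * (4 * F I + 4 * G I) by rewrite ler_wpM2l// lerD.
by lra.
Qed.

End tree.
End bellman.

(** * Dyadic intervals and averages *)

Section geometry.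
Context {R : realType}.
Notation mu := (@lebesgue_measure R).
Implicit Types (I J : dyadic) (f g w : R -> R).

Lemma dlen_gt0 I : 0 < dlen I :> R.
Proof. by rewrite /dlen exprz_gt0. Qed.

Lemma dlen_lhalf I : dlen (lhalf I) = dlen I / 2 :> R.
Proof. by rewrite /dlen/= opprD expfzDr// -invr_expz expr1z. Qed.

Lemma dlen_rhalf I : dlen (rhalf I) = dlen I / 2 :> R.
Proof. exact: dlen_lhalf. Qed.

Lemma in_dset I (x : R) :
  dset I x <-> I.2%:~R * dlen I <= x /\ x < I.2%:~R * dlen I + dlen I.
Proof.
rewrite /dset/= in_itv/= intrD mulrDl mul1r.
by split=> [/andP[]//|[-> ->]].
Qed.

Lemma in_dset_lhalf I (x : R) :
  dset (lhalf I) x <-> I.2%:~R * dlen I <= x /\ x < I.2%:~R * dlen I + dlen I /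
    2.
Proof.
rewrite in_dset dlen_lhalf /= intrM.
by rewrite (_ : 2%:~R * I.2%:~R * (dlen I / 2) = I.2%:~R * dlen I)//; lra.
Qed.

Lemma in_dset_rhalf I (x : R) :
  dset (rhalf I) x <-> I.2%:~R * dlen I + dlen I / 2 <= x /\
                       x < I.2%:~R * dlen I + dlen I.
Proof.
rewrite in_dset dlen_rhalf /= intrD intrM.
rewrite (_ : (2%:~R * I.2%:~R + 1) * (dlen I / 2) =
  I.2%:~R * dlen I + dlen I / 2); last by lra.
by rewrite (_ : _ + dlen I / 2 + dlen I / 2 = I.2%:~R * dlen I + dlen I);
  last lra.
Qed.

Lemma dset_halves I : dset I = dset (lhalf I) `|` dset (rhalf I) :> set R.
Proof.
apply/seteqP; split=> x; rewrite in_dset /setU/= in_dset_lhalf in_dset_rhalf.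
- move=> [? ?]; have [?|?] := ltP x (I.2%:~R * dlen I + dlen I / 2);
  by [left|right].
- by have dI := dlen_gt0 I; case=> -[? ?]; split; lra.
Qed.

Lemma dset_halves_disj I (x : R) :
  dset (lhalf I) x -> dset (rhalf I) x -> False.
Proof. by rewrite in_dset_lhalf in_dset_rhalf => -[? ?] [? ?]; lra. Qed.

Lemma measurable_dset I : measurable (dset I : set (measurableTypeR R)).
Proof. exact: measurable_itv. Qed.

Lemma dset_lhalf_sub I : dset (lhalf I) `<=` (dset I : set R).
Proof. by rewrite (dset_halves I); exact: subsetUl. Qed.

Lemma dset_rhalf_sub I : dset (rhalf I) `<=` (dset I : set R).
Proof. by rewrite (dset_halves I); exact: subsetUr. Qed.

Lemma lebesgue_measure_dset I : mu (dset I) = (dlen I)%:E.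
Proof.
rewrite /dset lebesgue_measure_itv/= lte_fin intrD mulrDl mul1r ltrDl dlen_gt0.
by rewrite -EFinB addrAC subrr add0r.
Qed.

Section integrable_real.
Variables (D : set (measurableTypeR R)) (mD : measurable D).

Lemma integrable_EFinD f g : mu.-integrable D (EFin \o f) ->
  mu.-integrable D (EFin \o g) ->
  mu.-integrable D (EFin \o (fun x => f x + g x)).
Proof. by move=> mf /(integrableD mD mf); exact: eq_integrable. Qed.

Lemma integrable_EFinZ (c : R) f : mu.-integrable D (EFin \o f) ->
  mu.-integrable D (EFin \o (fun x => c * f x)).
Proof. by move=> /(integrableZl mD c); exact: eq_integrable. Qed.

Lemma integrable_EFinB f g : mu.-integrable D (EFin \o f) ->
  mu.-integrable D (EFin \o g) ->
  mu.-integrable D (EFin \o (fun x => f x - g x)).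
Proof. by move=> mf /(integrableB mD mf); exact: eq_integrable. Qed.

End integrable_real.

(** The working form of local integrability: it makes every [avg] a true mean. *)
Definition dint f := forall I, mu.-integrable (dset I) (EFin \o f).

Lemma locally_integrable_dint f : locally_integrable [set: R] f -> dint f.
Proof.
move=> [mf _ fK] I.
apply: (@integrableS _ _ _ mu
    [set` `[I.2%:~R * dlen I, (I.2 + 1)%:~R * dlen I : R]]).
- exact: measurable_itv.
- exact: measurable_dset.
- by apply: subset_itvl; rewrite bnd_simp.
apply/integrableP; split.
  by apply/measurable_EFinP; exact: measurable_funTS.
by apply: fK => //; exact: segment_compact.
Qed.

Lemma dintD f g : dint f -> dint g -> dint (fun x => f x + g x).
Proof.
by move=> df dg I; apply: integrable_EFinD;
  [exact: measurable_dset|exact: df|exact: dg].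
Qed.

Lemma dintZ (c : R) f : dint f -> dint (fun x => c * f x).
Proof.
by move=> df I; apply: integrable_EFinZ; [exact: measurable_dset|exact: df].
Qed.

Lemma dint_norm f : dint f -> dint (fun x => `|f x|).
Proof.
move=> df I.
have := integrable_abse (df I).
by apply: eq_integrable => //; exact: measurable_dset.
Qed.

Lemma dint_cst (c : R) : dint (fun=> c).
Proof.
move=> I; apply/integrableP; split; first exact: measurable_cst.
under eq_integral do rewrite /=.
rewrite (integral_cst mu (measurable_dset I)) [X in (_ *
  X)%E]lebesgue_measure_dset.
by rewrite -EFinM ltry.
Qed.

Lemma dint_le f g : measurable_fun [set: R] f -> (forall x, `|f x| <= `|g x|) ->
  dint g -> dint f.
Proof.
move=> mf fg dg I; apply: le_integrable (dg I); first exact: measurable_dset.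
- by apply/measurable_EFinP; exact: measurable_funTS.
- by move=> x _; rewrite /= lee_fin.
Qed.

Lemma integrable_dint f : mu.-integrable setT (EFin \o f) -> dint f.
Proof.
by move=> fi I; apply: integrableS fi => //; exact: measurable_dset.
Qed.

Lemma avgE f I : dint f -> avg f I = (dlen I)^-1 * \int[mu]_(x in dset I) f x.
Proof.
move=> df; rewrite /avg /eavg fineM//.
by apply: integrable_fin_num; [exact: measurable_dset|exact: df].
Qed.

Lemma Rintegral_dset f I : dint f -> \int[mu]_(x in dset I) f x = dlen I * avg
  f I.
Proof. by move=> df; rewrite avgE// mulVKf ?gt_eqF ?dlen_gt0. Qed.

Lemma avg_martingale f : dint f -> martingale (avg f).
Proof.
move=> df I; rewrite !avgE// dlen_lhalf dlen_rhalf (dset_halves I).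
rewrite Rintegral_setU.
- by field; rewrite gt_eqF ?dlen_gt0.
- exact: measurable_dset.
- exact: measurable_dset.
- by rewrite -dset_halves.
- apply/disj_setPS => x [/dset_halves_disj]; exact.
Qed.

Lemma avg_le f g I : dint f -> dint g -> (forall x, f x <= g x) ->
  avg f I <= avg g I.
Proof.
move=> df dg fg; rewrite !avgE// ler_wpM2l//;
  first by rewrite invr_ge0 ltW ?dlen_gt0.
by apply: le_Rintegral => //; exact: measurable_dset.
Qed.

Lemma avgD f g I : dint f -> dint g ->
  avg (fun x => f x + g x) I = avg f I + avg g I.
Proof.
move=> df dg; rewrite !avgE//; last exact: dintD.
by rewrite RintegralD ?mulrDr//; exact: measurable_dset.
Qed.

Lemma avgZ (c : R) f I : dint f -> avg (fun x => c * f x) I = c * avg f I.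
Proof.
move=> df; rewrite !avgE//; last exact: dintZ.
by rewrite RintegralZl 1?mulrCA//; exact: measurable_dset.
Qed.

Lemma avg_cst (c : R) I : avg (fun=> c) I = c.
Proof.
rewrite avgE ?Rintegral_cst; last exact: dint_cst.
- by rewrite [X in fine X]lebesgue_measure_dset/= mulrCA mulVf ?mulr1// gt_eqF
  ?dlen_gt0.
- exact: measurable_dset.
Qed.

Lemma avg_ge0 f I : dint f -> (forall x, 0 <= f x) -> 0 <= avg f I.
Proof.
by move=> df f0; rewrite -(avg_cst 0 I) avg_le//; exact: dint_cst.
Qed.

Lemma avg_norm f I : dint f -> `|avg f I| <= avg (fun x => `|f x|) I.
Proof.
move=> df; have dnf := dint_norm df; rewrite ler_norml; apply/andP; split.
- rewrite lerNl -mulN1r -avgZ//; apply: avg_le => //; first exact: dintZ.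
  by move=> x; rewrite mulN1r -normrN ler_norm.
- by apply: avg_le => // x; rewrite ler_norm.
Qed.

(** Serves as Cauchy-Schwarz for averages and as the optimisation over [lam] in
    [sqnorm_shift_le]. *)
Lemma sqr_le_of_discr (X Y Z : R) : 0 <= Z ->
  (forall c : R, 0 <= X - 2 * c * Y + c ^+ 2 * Z) -> Y ^+ 2 <= X * Z.
Proof.
rewrite le_eqVlt => /predU1P[<- H|Z0 H].
  have [->|Y0] := eqVneq Y 0; first by rewrite expr0n mulr0.
  (* For Z = 0 the polynomial is affine in c, and this c gives it the value -1. *)
  have := H ((X + 1) / (2 * Y)).
  rewrite (_ : X - _ + _ = -1) ?oppr_ge0 ?ler10//.
  by field.
have := H (Y / Z); rewrite -(ler_pM2r Z0) mul0r.
rewrite (_ : (X - _ + _) * Z = X * Z - Y ^+ 2) ?subr_ge0//.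
by field; rewrite gt_eqF.
Qed.

(** * Cauchy-Schwarz for dual weights *)

Section dual_weights.
Variables (w v : R -> R).
Hypotheses (w0 : forall x, 0 < w x) (wv : forall x, w x * v x = 1).
Hypotheses (mw : measurable_fun [set: R] w) (dw : dint w).
Hypothesis dv : dint v.

Let vE x : v x = (w x)^-1.
Proof. by apply: (mulfI (lt0r_neq0 (w0 x))); rewrite wv divff ?gt_eqF. Qed.

Let v0 x : 0 < v x. Proof. by rewrite vE invr_gt0. Qed.

Lemma ler_young_weight (y c x : R) :
  0 <= y ^+ 2 * w x - 2 * c * y + c ^+ 2 * v x.
Proof.
have -> : y ^+ 2 * w x - 2 * c * y + c ^+ 2 * v x = w x * (y - c * v x) ^+ 2.
  by rewrite vE; field; rewrite gt_eqF.
by rewrite mulr_ge0 ?sqr_ge0// ltW.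
Qed.

(** The case c = 1 of [ler_young_weight] gives 2 |f| <= f^2 w + v. *)
Lemma dint_sq f : measurable_fun [set: R] f ->
  dint (fun x => f x ^+ 2 * w x) -> dint f.
Proof.
move=> mf df; apply: (dint_le mf _ (dintD df dv)) => x.
have wx := w0 x; have vx := v0 x.
have fx : 0 <= f x ^+ 2 * w x by apply: mulr_ge0; [exact: sqr_ge0|exact: ltW].
rewrite [leRHS]ger0_norm; last by lra.
have := ler_young_weight `|f x| 1 x; rewrite real_normK ?num_real//.
by lra.
Qed.

(** Averaging [ler_young_weight] gives a quadratic in c that is never negative; its discriminant
    yields the claim. *)
Lemma avg_cauchy_schwarz f I : dint f -> dint (fun x => f x ^+ 2 * w x) ->
  avg (fun x => `|f x|) I ^+ 2 <= avg (fun x => f x ^+ 2 * w x) I * avg v I.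
Proof.
move=> df df2; apply: sqr_le_of_discr => [|c].
  by apply: avg_ge0 => // x; exact: ltW.
have dnf := dint_norm df.
rewrite -[2 * c * _]avgZ// -avgZ// -mulN1r -avgZ; last exact: dintZ.
rewrite -avgD//; last exact/dintZ/dintZ.
rewrite -avgD; [|exact/dintD/dintZ/dintZ|exact: dintZ].
apply: avg_ge0.
  by apply: dintD; [exact/dintD/dintZ/dintZ|exact: dintZ].
move=> x; have := ler_young_weight `|f x| c x.
by rewrite real_normK ?num_real// mulN1r.
Qed.

Lemma avg_weights_ge1 I : 1 <= avg w I * avg v I.
Proof.
have := @avg_cauchy_schwarz (fun=> 1) I (dint_cst 1).
rewrite normr1 avg_cst !expr1n.
by under [in X in X -> _]eq_fun do rewrite mul1r; exact.
Qed.

Lemma avg_weight_gt0 I : 0 < avg w I.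
Proof.
have := avg_weights_ge1 I; rewrite lt_neqAle eq_sym avg_ge0// ?andbT.
- by apply: contraTneq => ->; rewrite mul0r ler10.
- by move=> x; exact: ltW.
Qed.

End dual_weights.

End geometry.

(** * Regions and Haar functions *)

Definition parent (I : dyadic) : dyadic := (I.1 - 1, (I.2 %/ 2)%Z).

Lemma parent_half I : I = lhalf (parent I) \/ I = rhalf (parent I).
Proof.
case: I => j k; rewrite /lhalf/rhalf/parent/= subrK.
have := divz_eq k 2; have := ltz_mod k (isT : 2 != 0 :> int).
have := modz_ge0 k (isT : 2 != 0 :> int).
move: (k %/ 2)%Z (k %% 2)%Z => a b ? ? ->.
have [->|->] : b = 0 \/ b = 1 by lia.
- by left; rewrite addr0 mulrC.
- by right; rewrite mulrC.
Qed.

(** * Exhaustion of the dyadic intervals by finite regions *)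

Section subtrees.
Implicit Types I J K : dyadic.

Lemma in_subtree n I J : (J \in subtree n.+1 I) =
  [|| J == I, J \in subtree n (lhalf I) | J \in subtree n (rhalf I)].
Proof. by rewrite inE mem_cat. Qed.

Lemma subtree_mono n m I J : (n <= m)%N -> J \in subtree n I -> J \in subtree m
  I.
Proof.
elim: n m I => // n IH [//|m] I nm; rewrite !in_subtree.
by case/or3P => [->//|/IH->//|/IH->//]; rewrite !orbT.
Qed.

Lemma subtree_child n I J : J \in subtree n I ->
  (lhalf J \in subtree n.+1 I) /\ (rhalf J \in subtree n.+1 I).
Proof.
have root m K : (0 < m)%N -> K \in subtree m K by case: m => //= m;
  rewrite inE eqxx.
elim: n I => [//|n IH] I; rewrite in_subtree.
rewrite (in_subtree n.+1 I (lhalf J)) (in_subtree n.+1 I (rhalf J)).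
by case/or3P => [/eqP->|/IH[-> ->]|/IH[-> ->]]; rewrite ?root ?orbT.
Qed.

(* The descendants of [-2^N, 0) and [0, 2^N) of length at least 2^-N; letting N
   grow exhausts all dyadic intervals with only two maximal ones. *)
Definition region (N : nat) : seq dyadic :=
  subtree (2 * N).+1 (- N%:Z, -1) ++ subtree (2 * N).+1 (- N%:Z, 0).

(** [-2^N, 0) is the right half of [-2^(N+1), 0) and [0, 2^N) the left half of [0, 2^(N+1)); the two
    new generations are one at the top and one at the bottom. *)
Lemma regionS N J : J \in region N -> J \in region N.+1.
Proof.
have sub I K : (rhalf K = I) \/ (lhalf K = I) -> J \in subtree (2 * N).+1 I ->
    J \in subtree (2 * N.+1).+1 K.
  rewrite mulnS add2n => KI JI; rewrite in_subtree.
  apply/orP; right; apply/orP; case: KI => KI; [right|left];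
    by rewrite KI; apply: subtree_mono JI.
rewrite !mem_cat => /orP[|] /sub JN; apply/orP; [left|right]; apply: JN.
- by left; rewrite /rhalf/=; congr pair; lia.
- by right; rewrite /lhalf/=; congr pair; lia.
Qed.

Lemma region_mono N M J : (N <= M)%N -> J \in region N -> J \in region M.
Proof.
move=> /subnKC <-; elim: (M - N)%N => [|m IH] JN; first by rewrite addn0.
by rewrite addnS; apply/regionS/IH.
Qed.

Lemma region_child N J : J \in region N ->
  (lhalf J \in region N.+1) /\ (rhalf J \in region N.+1).
Proof.
have sub I K J' : (rhalf K = I) \/ (lhalf K = I) ->
    J' \in subtree (2 * N).+2 I -> J' \in subtree (2 * N.+1).+1 K.
  rewrite mulnS add2n => KI JI; rewrite in_subtree.
  by apply/orP; right; apply/orP; case: KI => ->; [right|left].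
have sl : rhalf (- N.+1%:Z, -1) = (- N%:Z, -1).
  by rewrite /rhalf/=; congr pair; lia.
have sr : lhalf (- N.+1%:Z, 0) = (- N%:Z, 0).
  by rewrite /lhalf/=; congr pair; lia.
rewrite !mem_cat => /orP[|] /subtree_child[Jl Jr].
- by split; apply/orP; left; [apply: sub Jl|apply: sub Jr]; left.
- by split; apply/orP; right; [apply: sub Jl|apply: sub Jr]; right.
Qed.

(** Passing to the parent decreases |k| until k is 0 or -1. Such an interval is reached from a
    maximal one by left halves only, respectively right halves only. *)
Lemma region_exhaust J : exists N, J \in region N.
Proof.
have chain (k : int) (kh : lhalf (0, k) = (1, k) \/ rhalf (0, k) = (1, k)) j n :
    (j + n%:Z, k) \in subtree n.+1 (j, k).
  elim: n => [|n IH]; first by rewrite addr0 /= inE eqxx.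
  have [l r] := subtree_child IH.
  have e : j + n%:Z + 1 = j + n.+1%:Z by lia.
  by case: kh => -[kE]; [move: l|move: r]; rewrite /lhalf/rhalf/= e kE.
case: J => j k; elim: {k}_.+1 {-2}k (ltnSn `|k|%N) => // n IH k kn in j *.
have base : k = 0 \/ k = -1 -> exists N, (j, k) \in region N.
  move=> k0; exists (absz j); rewrite mem_cat.
  have [m [jm mj]] : exists m : nat,
    j = - (absz j)%:Z + m%:Z /\ (m <= 2 * absz j)%N.
    by exists (absz (j + (absz j)%:Z)); split; lia.
  apply/orP; case: k0 => ->; [right|left]; apply: (@subtree_mono m.+1) => //.
  - by rewrite {1}jm; apply: chain; left.
  - by rewrite {1}jm; apply: chain; right.
have [|k0] := boolP ((k == 0) || (k == -1)).
  by move=> kE; apply: base; case/orP: kE => /eqP ->; [left|right].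
have [N PN] : exists N, parent (j, k) \in region N.
  apply: IH; rewrite /=; move: k0 kn; have := divz_eq k 2.
  have := ltz_mod k (isT : 2 != 0 :> int).
  have := modz_ge0 k (isT : 2 != 0 :> int).
  by move: (k %/ 2)%Z (k %% 2)%Z => a b; lia.
exists N.+1; have [l r] := region_child PN.
by case: (parent_half (j, k)) => ->.
Qed.

Lemma region_seq (s : seq dyadic) : exists N, {subset s <= region N}.
Proof.
elim: s => [|J s [N sN]]; first by exists 0%N.
have [M JM] := region_exhaust J; exists (maxn M N) => K.
rewrite inE => /predU1P[->|/sN KN].
- exact: region_mono (leq_maxl _ _) JM.
- exact: region_mono (leq_maxr _ _) KN.
Qed.

End subtrees.

(** * Haar coefficients and orthonormality *)

Section haar_functions.
Context {R : realType}.
Notation mu := (@lebesgue_measure R).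
Implicit Types (I J K : dyadic) (f g w : R -> R).

Lemma sum_subtree (t : dyadic -> R) n I :
  \sum_(J <- subtree n I) dlen J * t J = dlen I * energy t n I.
Proof.
elim: n I => [|n IH] I /=; first by rewrite big_nil mulr0.
by rewrite big_cons big_cat/= !IH dlen_lhalf dlen_rhalf; lra.
Qed.

Lemma dset_inj I J (x : R) : I.1 = J.1 -> dset I x -> dset J x -> I = J.
Proof.
move=> IJ /in_dset[Ix xI] /in_dset[Jx xJ].
have dE : dlen I = dlen J :> R by rewrite /dlen IJ.
rewrite !dE in Ix xI.
have lt1 : I.2 < J.2 + 1.
  rewrite -(ltr_int R) -(ltr_pM2r (dlen_gt0 J)) intrD mulrDl mul1r.
  exact: le_lt_trans Ix _.
have lt2 : J.2 < I.2 + 1.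
  rewrite -(ltr_int R) -(ltr_pM2r (dlen_gt0 J)) intrD mulrDl mul1r.
  exact: le_lt_trans Jx _.
rewrite [I]surjective_pairing [J]surjective_pairing; congr pair => //; lia.
Qed.

(** The ancestor of J that is as long as K either equals K or is disjoint from it. *)
Lemma indic_dset_const K J : K.1 <= J.1 ->
  exists c : R, forall x : R, dset J x -> \1_(dset K) x = c.
Proof.
move=> KJ; have [n] : exists n : nat, J.1 = K.1 + n%:Z.
  by exists (absz (J.1 - K.1)); lia.
elim: n J {KJ} => [|n IH] J Jn.
  have [<-|neq] := eqVneq K J.
    by exists 1 => x Kx; rewrite indicE mem_set.
  exists 0 => x Jx; rewrite indicE memNset// => Kx.
  by rewrite (dset_inj _ Kx Jx) ?eqxx// Jn addr0 in neq.
have [c Pc] := IH (parent J) ltac:(rewrite /=; lia).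
exists c => x Jx; apply: Pc.
by case: (parent_half J) => JE; rewrite JE in Jx;
  [exact: dset_lhalf_sub Jx|exact: dset_rhalf_sub Jx].
Qed.

Lemma measurable_haar I : measurable_fun [set: R] (haar I).
Proof.
apply: measurable_funM; first exact: measurable_cst.
by apply: measurable_funB; apply: measurable_indic; exact: measurable_dset.
Qed.

Lemma mul_haarE f I x : f x * haar I x =
  (Num.sqrt (dlen I))^-1 * ((f \_ (dset (rhalf I))) x - (f \_ (dset (lhalf I)))
    x).
Proof.
rewrite /haar mulrCA mulrBr !patchE !indicE; congr (_ * (_ - _));
by case: ifP; rewrite ?mulr1 ?mulr0.
Qed.

Lemma integrable_restrict_dset f I : dint f ->
  mu.-integrable setT (EFin \o (f \_ (dset I))).
Proof.
move=> df; rewrite -restrict_EFin.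
by apply: (integrable_mkcond _ (measurable_dset I)).1; exact: df.
Qed.

Lemma integrable_mul_haar f I : dint f ->
  mu.-integrable setT (EFin \o (fun x => f x * haar I x)).
Proof.
move=> df; under [X in _ \o X]eq_fun do rewrite mul_haarE.
by apply: integrable_EFinZ => //; apply: integrable_EFinB => //;
  exact: integrable_restrict_dset.
Qed.

Lemma pairing_haar f I : dint f ->
  pairing f (haar I) = Num.sqrt (dlen I) * hdiff (avg f) I.
Proof.
move=> df; rewrite /pairing; under eq_Rintegral do rewrite mul_haarE.
have ir := integrable_restrict_dset (rhalf I) df.
have il := integrable_restrict_dset (lhalf I) df.
rewrite RintegralZl//; last exact: integrable_EFinB.
rewrite RintegralB// -!Rintegral_mkcond !Rintegral_dset//.
rewrite dlen_lhalf dlen_rhalf /hdiff -mulrBr.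
have d0 : 0 < Num.sqrt (dlen I) :> R by rewrite sqrtr_gt0 dlen_gt0.
rewrite -[dlen I in LHS]sqr_sqrtr ?ltW ?dlen_gt0//.
rewrite sqrtr_sqr gtr0_norm//.
by field; rewrite gt_eqF.
Qed.

Lemma eq_avg f g I : (forall x : R, dset I x -> f x = g x) -> avg f I = avg g I.
Proof.
move=> fg; rewrite /avg /eavg; congr (fine (_ * _)).
by apply: eq_integral => x; rewrite inE => /fg ->.
Qed.

Lemma avg_const f I c : (forall x : R, dset I x -> f x = c) -> avg f I = c.
Proof. by move=> /eq_avg ->; exact: avg_cst. Qed.

Lemma haar_bound I (x : R) : `|haar I x| <= (Num.sqrt (dlen I))^-1.
Proof.
rewrite /haar normrM ger0_norm ?invr_ge0 ?sqrtr_ge0//.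
rewrite ler_piMr ?invr_ge0 ?sqrtr_ge0//.
by rewrite !indicE; do 2 case: (_ \in _);
  rewrite ?subrr ?subr0 ?sub0r ?normrN ?normr0 ?normr1.
Qed.

Lemma dint_haar I : dint (@haar R I).
Proof.
apply: dint_le (measurable_haar I) _ (dint_cst (Num.sqrt (dlen I))^-1) => x.
by rewrite [leRHS]ger0_norm ?haar_bound// invr_ge0 sqrtr_ge0.
Qed.

Lemma haar_rhalf I (x : R) : dset (rhalf I) x -> haar I x = (Num.sqrt (dlen
  I))^-1.
Proof.
move=> Ix; rewrite /haar !indicE mem_set// memNset ?subr0 ?mulr1//.
by move=> /dset_halves_disj; exact.
Qed.

Lemma haar_lhalf I (x : R) : dset (lhalf I) x -> haar I x = - (Num.sqrt (dlen
  I))^-1.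
Proof.
move=> Ix; rewrite /haar !indicE memNset => [|/(dset_halves_disj Ix)]//.
by rewrite mem_set// sub0r mulrN1.
Qed.

Lemma haar_const I J : I.1 < J.1 ->
  exists c : R, forall x : R, dset J x -> haar I x = c.
Proof.
move=> IJ.
have [c Pc] := @indic_dset_const (rhalf I) J ltac:(rewrite /=; lia).
have [c' Pc'] := @indic_dset_const (lhalf I) J ltac:(rewrite /=; lia).
exists ((Num.sqrt (dlen I))^-1 * (c - c')) => x Jx.
by rewrite /haar Pc// Pc'.
Qed.

(** By symmetry I is at least as long as J. If they differ, h_I is constant on J (zero there when
    the lengths agree), so its averages have no difference at J. *)
Lemma haar_orthonormal I J : pairing (@haar R I) (haar J) = (I == J)%:R.
Proof.
wlog IJ : I J / I.1 <= J.1.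
  move=> H; have [|/ltW] := leP I.1 J.1; first exact: H.
  move=> /H; rewrite eq_sym => <-; rewrite /pairing.
  by under eq_Rintegral do rewrite mulrC.
rewrite pairing_haar; last exact: dint_haar.
have d0 : 0 < Num.sqrt (dlen J) :> R by rewrite sqrtr_gt0 dlen_gt0.
have [<-|neq] := eqVneq I J.
  rewrite /hdiff (avg_const (@haar_rhalf I)) (avg_const (@haar_lhalf I)) /=.
  by field; rewrite gt_eqF// sqrtr_gt0 dlen_gt0.
suff [c Pc] : exists c : R, forall x : R, dset J x -> haar I x = c.
  rewrite /hdiff (@avg_const _ _ c) => [|x /dset_rhalf_sub]; last exact: Pc.
  rewrite (@avg_const _ _ c) => [|x /dset_lhalf_sub]; last exact: Pc.
  by rewrite subrr mul0r mulr0.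
move: IJ; rewrite le_eqVlt => /predU1P[IJ|]; last exact: haar_const.
exists 0 => x Jx; have nI : ~ dset I x.
  by move=> Ix; rewrite (dset_inj IJ Ix Jx) eqxx in neq.
rewrite /haar !indicE !memNset ?subrr ?mulr0//.
- by move=> /dset_lhalf_sub.
- by move=> /dset_rhalf_sub.
Qed.

End haar_functions.

(** * Uniform bound for finite shifts *)

Section sum_undup.
Context {R : realFieldType}.

(** Passes from concatenated subtrees to the list of a region without repetitions. *)
Lemma ler_sum_undup (T : eqType) (s : seq T) (F : T -> R) :
  (forall i, 0 <= F i) -> \sum_(i <- undup s) F i <= \sum_(i <- s) F i.
Proof.
move=> F0; elim: s => [|i s IH] /=; first by rewrite !big_nil.
case: ifP => _; rewrite !big_cons ?lerD2l//.
by rewrite (le_trans IH)// lerDr.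
Qed.

End sum_undup.

Section shift.
Context {R : realType}.
Notation mu := (@lebesgue_measure R).
Implicit Types (I J K : dyadic) (f g w : R -> R).

Definition sqint w f := measurable_fun [set: R] f /\
  mu.-integrable [set: R] (EFin \o (fun x => f x ^+ 2 * w x)).

Definition sqnorm w f : R := \int[mu]_x (f x ^+ 2 * w x).

(** The coefficients p and q are free so that [shift_cauchy] can vary their signs. *)
Definition shift (s : seq dyadic) (p q : dyadic -> R) f (x : R) : R :=
  \sum_(I <- s) pairing f (haar I) *
    (p I * haar (lhalf I) x + q I * haar (rhalf I) x).

Lemma pairing_sum g (s : seq dyadic) (c : dyadic -> R) (F : dyadic -> R -> R) :
  (forall I, mu.-integrable setT (EFin \o (fun x => g x * F I x))) ->
  mu.-integrable setT (EFin \o (fun x => g x * \sum_(I <- s) c I * F I x)) /\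
  pairing g (fun x => \sum_(I <- s) c I * F I x) =
    \sum_(I <- s) c I * pairing g (F I).
Proof.
move=> gF; elim: s => [|I s [IH1 IH2]].
  have E x : g x * (\sum_(J <- [::]) c J * F J x) = 0.
    by rewrite big_nil mulr0.
  split; first by under [X in _ \o X]eq_fun do rewrite E; exact: integrable0.
  rewrite /pairing; under eq_Rintegral do rewrite E.
  by rewrite Rintegral_cst// mul0r big_nil.
have E x : g x * (\sum_(J <- I :: s) c J * F J x) =
    c I * (g x * F I x) + g x * (\sum_(J <- s) c J * F J x).
  by rewrite big_cons mulrDr mulrCA.
have iI : mu.-integrable setT (EFin \o (fun x => c I * (g x * F I x))).
  exact: integrable_EFinZ.
split.
  by under [X in _ \o X]eq_fun do rewrite E; exact: integrable_EFinD.
rewrite /pairing; under eq_Rintegral do rewrite E.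
by rewrite RintegralD// RintegralZl// big_cons -IH2.
Qed.

Lemma mul_haar2E (u a b h k : R) :
  u * (a * h + b * k) = a * (u * h) + b * (u * k).
Proof. by ring. Qed.

Lemma integrable_mul_haar2 g (a b : R) I J : dint g ->
  mu.-integrable setT (EFin \o (fun x => g x * (a * haar I x + b * haar J x))).
Proof.
move=> dg; under [X in _ \o X]eq_fun do rewrite mul_haar2E.
by apply: integrable_EFinD => //; apply: integrable_EFinZ => //;
  exact: integrable_mul_haar.
Qed.

Lemma pairing_haar2 g (a b : R) I J : dint g ->
  pairing g (fun x => a * haar I x + b * haar J x) =
  a * pairing g (haar I) + b * pairing g (haar J).
Proof.
move=> dg; rewrite /pairing.
under eq_Rintegral do rewrite mul_haar2E.
have iI := integrable_mul_haar I dg; have iJ := integrable_mul_haar J dg.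
by rewrite RintegralD ?RintegralZl//; exact: integrable_EFinZ.
Qed.

Lemma pairing_shift s p q f g : dint g ->
  pairing g (shift s p q f) = \sum_(I <- s) pairing f (haar I) *
    (p I * pairing g (haar (lhalf I)) + q I * pairing g (haar (rhalf I))).
Proof.
move=> dg; have [_ ->] := @pairing_sum g s (fun I => pairing f (haar I))
  (fun I x => p I * haar (lhalf I) x + q I * haar (rhalf I) x)
  (fun I => integrable_mul_haar2 (p I) (q I) (lhalf I) (rhalf I) dg).
by under eq_bigr do rewrite pairing_haar2//.
Qed.

(** * The weighted space of square integrable functions *)

Section sqint.
Variables (w : R -> R).
Hypotheses (w0 : forall x, 0 < w x) (mw : measurable_fun [set: R] w).

Lemma sqintP f : measurable_fun [set: R] f ->
  (\int[mu]_x (f x ^+ 2 * w x)%:E < +oo)%E -> sqint w f.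
Proof.
move=> mf foo; split => //; apply/integrableP; split.
  apply/measurable_EFinP; apply: measurable_funM => //.
  exact: measurable_funX.
apply: le_lt_trans foo; rewrite le_eqVlt; apply/orP; left; apply/eqP.
apply: eq_integral => x _ /=; rewrite ger0_norm//.
by apply: mulr_ge0; [exact: sqr_ge0|exact: ltW].
Qed.

Lemma sqnormE f : sqint w f ->
  (\int[mu]_x (f x ^+ 2 * w x)%:E)%E = (sqnorm w f)%:E.
Proof.
by move=> [_ fi]; rewrite /sqnorm /Rintegral fineK//; exact: integrable_fin_num.
Qed.

Lemma sqnorm_ge0 f : 0 <= sqnorm w f.
Proof.
by apply: Rintegral_ge0 => x _; apply: mulr_ge0; [exact: sqr_ge0|exact: ltW].
Qed.

Lemma sqint_le f g (c : R) : sqint w g -> measurable_fun [set: R] f ->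
  (forall x, f x ^+ 2 <= c * g x ^+ 2) -> sqint w f.
Proof.
move=> [mg gi] mf fg; split => //.
apply: le_integrable (integrable_EFinZ measurableT c gi) => //.
  apply/measurable_EFinP; apply: measurable_funM => //.
  exact: measurable_funX.
move=> x _; rewrite /= lee_fin ger0_norm; last first.
  by apply: mulr_ge0; [exact: sqr_ge0|exact: ltW].
by rewrite (le_trans _ (ler_norm _))// mulrA ler_wpM2r// ltW.
Qed.

Lemma sqintZ (c : R) f : sqint w f -> sqint w (fun x => c * f x).
Proof.
move=> fi; apply: (@sqint_le _ f (c ^+ 2)) => //.
- by apply: measurable_funM => //; case: fi.
- by move=> x; rewrite exprMn.
Qed.

Lemma sqintD f g : sqint w f -> sqint w g -> sqint w (fun x => f x + g x).
Proof.
move=> [mf fi] [mg gi]; split; first exact: measurable_funD.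
apply: (@le_integrable _ _ _ mu _ _ _
   (EFin \o (fun x => 2 * (f x ^+ 2 * w x) + 2 * (g x ^+ 2 * w x)))) => //.
- apply/measurable_EFinP; apply: measurable_funM => //.
  by apply: measurable_funX; exact: measurable_funD.
- move=> x _; rewrite /= lee_fin ger0_norm; last first.
    by apply: mulr_ge0; [exact: sqr_ge0|exact: ltW].
  rewrite (le_trans _ (ler_norm _))// !mulrA -mulrDl ler_wpM2r//;
    first exact: ltW.
  by have := sqr_ge0 (f x - g x); lra.
- by apply: integrable_EFinD => //; exact: integrable_EFinZ.
Qed.

Lemma sqintB f g : sqint w f -> sqint w g -> sqint w (fun x => f x - g x).
Proof.
move=> fi gi.
have -> : (fun x => f x - g x) = (fun x => f x + (-1) * g x).
  by apply/funext => x; rewrite mulN1r.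
by apply: sqintD => //; exact: sqintZ.
Qed.

Lemma sqint0 : sqint w (fun=> 0).
Proof.
split; first exact: measurable_cst.
by under eq_fun do rewrite expr0n mul0r; exact: integrable0.
Qed.

Lemma sqnormZ (c : R) f : sqint w f ->
  sqnorm w (fun x => c * f x) = c ^+ 2 * sqnorm w f.
Proof.
move=> [_ fi]; rewrite /sqnorm; under eq_Rintegral do rewrite exprMn -mulrA.
by rewrite RintegralZl.
Qed.

Lemma sqnorm_parallelogram f g : sqint w f -> sqint w g ->
  sqnorm w (fun x => f x + g x) + sqnorm w (fun x => f x - g x) =
  2 * sqnorm w f + 2 * sqnorm w g.
Proof.
move=> fi gi; have [_ si] := sqintD fi gi.
have [_ ti] := sqintB fi gi.
rewrite /sqnorm -RintegralD//; case: fi gi => _ fi [_ gi].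
rewrite -!RintegralZl// -RintegralD//; try exact: integrable_EFinZ.
by apply: eq_Rintegral => x _; ring.
Qed.

End sqint.

Section dual.
Variables (w v : R -> R).
Hypotheses (w0 : forall x, 0 < w x) (wv : forall x, w x * v x = 1).
Hypothesis dv : dint v.

Lemma sqint_dint f : sqint w f -> dint f.
Proof.
by move=> [mf fi]; apply: (dint_sq w0 wv dv mf); exact: integrable_dint.
Qed.

Lemma dlen_avg_le_sqnorm f I : sqint w f ->
  dlen I * avg (fun x => f x ^+ 2 * w x) I <= sqnorm w f.
Proof.
move=> [mf fi]; rewrite -Rintegral_dset; last exact: integrable_dint.
rewrite Rintegral_mkcond; apply: le_Rintegral => //.
  by apply: integrable_restrict_dset; exact: integrable_dint.
move=> x _; rewrite patchE; case: ifP => // _.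
by apply: mulr_ge0; [exact: sqr_ge0|exact: ltW].
Qed.

End dual.

(** * Duality and the uniform operator bound *)

Section bound.
Variables (w v : R -> R).
Hypotheses (w0 : forall x, 0 < w x) (wv : forall x, w x * v x = 1).
Hypotheses (mw : measurable_fun [set: R] w) (dw : dint w).
Hypothesis dv : dint v.
Variable W : R.
Hypothesis wvW : forall I, avg w I * avg v I <= W.

Let v0 x : 0 < v x.
Proof. by rewrite -(pmulr_rgt0 _ (w0 x)) wv. Qed.

Let vw x : v x * w x = 1. Proof. by rewrite mulrC. Qed.

Let W0 : 0 <= W.
Proof. by rewrite (le_trans _ (wvW (0, 0)))// mulr_ge0// avg_ge0// => x;
  exact: ltW. Qed.

Lemma sum_subtree_term f g n I : sqint w f -> sqint v g ->
  \sum_(J <- subtree n I) dlen J * shift_term (avg f) (avg g) J <=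
  768 * W * (sqnorm w f + sqnorm v g).
Proof.
move=> fi gi; have df := sqint_dint w0 wv dv fi.
have dg := sqint_dint v0 vw dw gi.
have df2 := integrable_dint fi.2; have dg2 := integrable_dint gi.2.
rewrite sum_subtree.
have En := energy_le (avg_martingale df)
  (avg_martingale (dint_norm df)) (avg_martingale df2) (avg_martingale dv)
  (avg_martingale dg) (avg_martingale (dint_norm dg)) (avg_martingale dg2)
  (avg_martingale dw) (fun J => avg_norm J df) (fun J => avg_norm J dg)
  (avg_weight_gt0 v0 vw dv dw) (avg_weight_gt0 w0 wv dw dv)
  (fun J => avg_cauchy_schwarz w0 wv dv J df df2)
  (fun J => avg_cauchy_schwarz v0 vw dw J dg dg2)
  (avg_weights_ge1 w0 wv dw dv) wvW n I.
apply: le_trans (ler_wpM2l (ltW (dlen_gt0 I)) En) _.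
have Ff := dlen_avg_le_sqnorm w0 I fi; have Gg := dlen_avg_le_sqnorm v0 I gi.
have := ler_wpM2l W0 (lerD Ff Gg).
set F := avg _ I in Ff *; set G := avg (fun _ => g _ ^+ 2 * _) I in Gg *.
by clearbody F G => H; lra.
Qed.

(** Two maximal intervals, each estimated by the full norms, double 768 to 1536. *)
Lemma sum_region_term f g N : sqint w f -> sqint v g ->
  \sum_(J <- undup (region N)) dlen J * shift_term (avg f) (avg g) J <=
  1536 * W * (sqnorm w f + sqnorm v g).
Proof.
move=> fi gi; apply: le_trans (ler_sum_undup _ _) _.
  move=> J; rewrite mulr_ge0//; first exact/ltW/dlen_gt0.
  by rewrite /shift_term mulr_ge0// addr_ge0.
rewrite big_cat/=.
have := sum_subtree_term (2 * N).+1 (- N%:Z, -1) fi gi.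
have := sum_subtree_term (2 * N).+1 (- N%:Z, 0) fi gi.
by lra.
Qed.

(** By [pairing_haar] each product of coefficients carries a factor sqrt |I| sqrt (|I|/2) <= |I|, as
    in [sum_region_term]. *)
Lemma pairing_shift_le f g N (p q : dyadic -> R) (beta : R) :
  (forall I, `|p I| <= beta) -> (forall I, `|q I| <= beta) ->
  sqint w f -> sqint v g ->
  pairing g (shift (undup (region N)) p q f) <=
  1536 * W * beta * (sqnorm w f + sqnorm v g).
Proof.
move=> pb qb fi gi; have df := sqint_dint w0 wv dv fi.
have dg := sqint_dint v0 vw dw gi.
have b0 : 0 <= beta := le_trans (normr_ge0 _) (pb (0, 0)).
rewrite pairing_shift//.
rewrite [1536 * W * beta]mulrC -mulrA.
apply: le_trans (ler_wpM2l b0 (sum_region_term N fi gi)).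
rewrite mulr_sumr; apply: ler_sum => I _.
rewrite !pairing_haar// dlen_lhalf dlen_rhalf.
have d0 := dlen_gt0 I : 0 < dlen I :> R.
set r := Num.sqrt (dlen I); set h := Num.sqrt (dlen I / 2).
have r0 : 0 <= r by exact: sqrtr_ge0.
have h0 : 0 <= h by exact: sqrtr_ge0.
have hr : h <= r by rewrite ler_sqrt//; lra.
have rr : r * r = dlen I by rewrite -expr2 sqr_sqrtr// ltW.
rewrite /shift_term; set x := hdiff _ I; set y := hdiff _ (lhalf I);
  set z := hdiff _ _.
clearbody x y z r h.
apply: le_trans (ler_norm _) _; rewrite !normrM (ger0_norm r0).
have -> : beta * (dlen I * (`|x| * (`|y| + `|z|))) =
  (r * `|x|) * (beta * (r * `|y|) + beta * (r * `|z|)) by rewrite -rr; ring.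
rewrite ler_wpM2l ?mulr_ge0// (le_trans (ler_normD _ _))//.
rewrite !normrM (ger0_norm h0) lerD//.
- by rewrite ler_pM ?mulr_ge0// ler_wpM2r.
- by rewrite ler_pM ?mulr_ge0// ler_wpM2r.
Qed.

Lemma sqint_haar I : sqint w (@haar R I).
Proof.
split; first exact: measurable_haar.
have di := integrable_restrict_dset I dw.
apply: le_integrable (integrable_EFinZ measurableT (dlen I)^-1 di) => //.
  apply/measurable_EFinP; apply: measurable_funM => //.
  by apply: measurable_funX; exact: measurable_haar.
move=> x _; rewrite /= lee_fin patchE.
case: ifPn => [_|]; last first.
  rewrite notin_setE => nI; rewrite /haar !indicE !memNset ?subrr ?mulr0
    ?expr0n ?mul0r//.
  - by move=> /dset_lhalf_sub.
  - by move=> /dset_rhalf_sub.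
have hb : haar I x ^+ 2 <= (dlen I)^-1.
  rewrite -(real_normK (num_real _)).
  apply: le_trans (_ : (Num.sqrt (dlen I))^-1 ^+ 2 <= _).
    by rewrite lerXn2r ?nnegrE ?invr_ge0 ?sqrtr_ge0 ?haar_bound.
  by rewrite exprVn sqr_sqrtr// ltW// dlen_gt0.
rewrite (le_trans _ (ler_norm _))// ger0_norm; last first.
  by apply: mulr_ge0; [exact: sqr_ge0|exact: ltW].
by rewrite ler_wpM2r// ltW.
Qed.

Lemma sqint_shift s p q f : sqint w (shift s p q f).
Proof.
rewrite /shift; elim: s => [|I s IH].
  by under eq_fun do rewrite big_nil; exact: sqint0.
under eq_fun do rewrite big_cons.
apply: sqintD => //; apply: sqintZ => //.
by apply: sqintD => //; apply: sqintZ => //; exact: sqint_haar.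
Qed.

Lemma sqnorm_shift_le f N (p q : dyadic -> R) (beta : R) :
  (forall I, `|p I| <= beta) -> (forall I, `|q I| <= beta) -> sqint w f ->
  sqnorm w (shift (undup (region N)) p q f) <=
  (3072 * W * beta) ^+ 2 * sqnorm w f.
Proof.
move=> pb qb fi; set h := shift _ _ _ _.
have hi : sqint w h by exact: sqint_shift.
have b0 : 0 <= beta := le_trans (normr_ge0 _) (pb (0, 0)).
pose K : R := 1536 * W * beta.
have K0 : 0 <= K by exact: mulr_ge0 (mulr_ge0 (ler0n _ _) W0) b0.
have X0 := sqnorm_ge0 w0 f; have Y0 := sqnorm_ge0 w0 h.
(* The test function [lam] h w has in L^2(v) the squared norm of [lam] h in L^2(w), and its pairing
   with h is [lam] times the squared norm of h. *)
have main lam : lam * sqnorm w h <= K * (sqnorm w f + lam ^+ 2 * sqnorm w h).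
  have Ex x : (lam * (h x * w x)) ^+ 2 * v x = (lam * h x) ^+ 2 * w x.
    transitivity ((lam * h x) ^+ 2 * w x * (w x * v x));
      last by rewrite wv mulr1.
    by ring.
  have E : sqnorm v (fun x => lam * (h x * w x)) = lam ^+ 2 * sqnorm w h.
    by rewrite -sqnormZ//; apply: eq_Rintegral => x _; exact: Ex.
  have gi : sqint v (fun x => lam * (h x * w x)).
    split.
      apply: measurable_funM => //; apply: measurable_funM => //.
      by case: hi.
    have [_] := sqintZ w0 mw lam hi; apply: eq_integrable => // x _ /=.
    by rewrite Ex.
  have := pairing_shift_le N pb qb fi gi; rewrite -/K E -/h.
  apply: le_trans; rewrite le_eqVlt; apply/orP; left; apply/eqP.
  rewrite -RintegralZl//; last by case: hi.
  by apply: eq_Rintegral => x _; ring.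
(* This is the discriminant of [main] as a quadratic in [lam]; dividing by the norm of h, when it is
   not 0, leaves the factor (2 K)^2. *)
have : (sqnorm w h / 2) ^+ 2 <= (K * sqnorm w f) * (K * sqnorm w h).
  apply: sqr_le_of_discr => [|c]; first by rewrite mulr_ge0.
  by have := main c; lra.
move: Y0; rewrite le_eqVlt => /predU1P[<- _|Y0].
  by rewrite mulr_ge0 ?sqr_ge0.
have KE : 3072 * W * beta = 2 * K by rewrite /K; ring.
rewrite KE; clearbody K.
by move=> H; rewrite -(ler_pM2r Y0); move: H; lra.
Qed.

End bound.
End shift.

(** * Completeness of weighted L2 *)

Section riesz_fischer.
Context {R : realType}.
Notation mu := (@lebesgue_measure R).
Variables (w : R -> R).
Hypotheses (w0 : forall x, 0 < w x) (mw : measurable_fun [set: R] w).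

Lemma limn_einf_le (a : (\bar R)^nat) (l : \bar R) N :
  (forall n, (N <= n)%N -> (a n <= l)%E) -> (limn_einf a <= l)%E.
Proof.
move=> al; rewrite limn_einf_lim; apply: lime_le.
  by apply: ereal_nondecreasing_is_cvgn; exact: nondecreasing_einfs.
apply: nearW => n; rewrite /einfs; apply: le_trans (al (maxn N n) _).
- by apply: ereal_inf_lbound; exists (maxn N n) => //=; exact: leq_maxr.
- exact: leq_maxl.
Qed.

(** The increments are at most sqrt (B / c) 2^-k, so the telescoping series converges absolutely. *)
Lemma cvg_of_sqr_summable (u : R^nat) (c B : R) : 0 < c ->
  (forall k, 4 ^+ k * ((u k.+1 - u k) ^+ 2 * c) <= B) -> cvgn u.
Proof.
move=> c0 uB.
have B0 : 0 <= B.
  apply: le_trans (uB 0%N); apply: mulr_ge0; first exact: exprn_ge0.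
  by apply: mulr_ge0; [exact: sqr_ge0|exact: ltW].
pose b := Num.sqrt (B / c).
have Bc : 0 <= B / c by rewrite divr_ge0// ltW.
have step k : `|u k.+1 - u k| <= geometric b (2^-1) k.
  have sq : (u k.+1 - u k) ^+ 2 <= (b * 2^-1 ^+ k) ^+ 2.
    rewrite exprMn sqr_sqrtr// !exprVn -exprM mulnC exprM.
    have -> : 2 ^+ 2 = 4 :> R by ring.
    rewrite ler_pdivlMr ?exprn_gt0// ler_pdivlMr//.
    by apply: le_trans (uB k); rewrite mulrA [4 ^+ k * _]mulrC.
  have b0 : 0 <= b * 2^-1 ^+ k by apply: mulr_ge0;
    [exact: sqrtr_ge0|exact: exprn_ge0].
  rewrite /geometric/= -(ler_pXn2r (isT : (0 < 2)%N)) ?nnegrE//.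
  by rewrite real_normK ?num_real.
suff : cvgn (series (telescope u)).
  move=> ct; rewrite (funext (eq_sum_telescope u)).
  exact: is_cvgD (is_cvg_cst _) ct.
apply: normed_cvg; apply: series_le_cvg step _ => //.
- by move=> k; rewrite /geometric/= mulr_ge0 ?sqrtr_ge0 ?exprn_ge0.
- by apply: is_cvg_geometric_series; rewrite ger0_norm// invf_lt1 ?ltr1n.
Qed.

Lemma subseq_cauchy (a : nat -> nat -> R) (e : nat -> R) :
  (forall k, 0 < e k) ->
  (forall d : R, 0 < d -> exists N, forall n m,
    (N <= n)%N -> (N <= m)%N -> a n m <= d) ->
  exists n_ : nat -> nat,
    [/\ forall k, (n_ k <= n_ k.+1)%N, forall k, (k <= n_ k)%N &
        forall k, a (n_ k.+1) (n_ k) <= e k].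
Proof.
move=> e0 aC.
have [N aN] := choice (fun k => aC (e k) (e0 k)).
pose n_ := fix n_ k := if k is k'.+1 then maxn (n_ k').+1 (N k) else N 0%N.
have nS k : (n_ k < n_ k.+1)%N by exact: leq_maxl.
have Nn k : (N k <= n_ k)%N by case: k => //= k; exact: leq_maxr.
exists n_; split.
- by move=> k; exact: ltnW.
- by elim=> // k; move=> /leq_ltn_trans; apply.
- by move=> k; apply: aN => //; exact: leq_trans (ltnW (nS k)).
Qed.

(** The integrals of 4^k d_k^2 w sum to at most 1, so the series itself is finite almost everywhere
    and bounds each of its terms. *)
Lemma ae_cvg_subseq (d : nat -> R -> R) :
  (forall k, sqint w (d k)) ->
  (forall k, 4 ^+ k * sqnorm w (d k) <= 1 / (2 ^ k.+1)%:R) ->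
  exists E : set R, [/\ measurable (E : set (measurableTypeR R)),
    mu.-negligible (~` E) &
    forall x, E x -> exists B, forall k, 4 ^+ k * (d k x ^+ 2 * w x) <= B].
Proof.
move=> di dle.
pose F k x : \bar R := (4 ^+ k * (d k x ^+ 2 * w x))%:E.
have F0 k x : (0 <= F k x)%E.
  
  rewrite lee_fin; apply: mulr_ge0; first exact: exprn_ge0.
  by apply: mulr_ge0; [exact: sqr_ge0|exact: ltW].
have mF k : measurable_fun [set: R] (F k).
  apply/measurable_EFinP; apply: measurable_funM => //;
    apply: measurable_funM => //.
  by apply: measurable_funX; case: (di k).
have FI k : (\int[mu]_x F k x = (4 ^+ k * sqnorm w (d k))%:E)%E.
  rewrite EFinM -(sqnormE (di k)) -ge0_integralZl//.
  - by apply/measurable_EFinP; apply: measurable_funM => //;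
      apply: measurable_funX; case: (di k).
  - by move=> x _; rewrite lee_fin; apply: mulr_ge0;
    [exact: sqr_ge0|exact: ltW].
pose S x := (\sum_(0 <= k <oo) F k x)%E.
have mS : measurable_fun [set: R] S by exact: ge0_emeasurable_sum.
have S0 x : (0 <= S x)%E by exact: nneseries_ge0.
have SI : mu.-integrable setT S.
  apply/integrableP; split => //.
  under eq_integral do rewrite gee0_abs//.
  rewrite /S integral_nneseries//.
  apply: (@le_lt_trans _ _ 1%:E); last exact: ltry.
  apply: le_trans (@epsilon_trick0 R 1 xpredT ler01).
  apply: lee_nneseries => [k _ _|k _]; first by apply: integral_ge0.
  by rewrite FI lee_fin.
exists [set x | (S x < +oo)%E]; split.
- by rewrite -[X in measurable X]setTI; exact: emeasurable_fun_infty_o.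
- have := integrable_ae measurableT SI; apply: negligibleS => x /= nS fS.
  by apply: nS; rewrite -ge0_fin_numE//; exact: fS.
- move=> x /= Sx; exists (fine (S x)) => k.
  rewrite -lee_fin fineK ?ge0_fin_numE//.
  apply: le_trans (nneseries_lim_ge k.+1 _) => //.
  rewrite big_nat_recr//= leeDr// sume_ge0// => i _; exact: F0.
Qed.

(** An eventual bound on the distance from [u n] to h passes to g. The choice h = 0 bounds the norm
    of g; a member of the sequence as h gives convergence. *)
Lemma riesz_fischer (u : nat -> R -> R) :
  (forall n, sqint w (u n)) ->
  (forall e : R, 0 < e -> exists N, forall n m, (N <= n)%N -> (N <= m)%N ->
     sqnorm w (fun x => u n x - u m x) <= e) ->
  exists g, sqint w g /\
    forall h e N, sqint w h ->
      (forall n, (N <= n)%N -> sqnorm w (fun x => u n x - h x) <= e) ->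
      sqnorm w (fun x => g x - h x) <= e.
Proof.
move=> ui uC.
pose e k : R := (4 ^+ k)^-1 * (1 / (2 ^ k.+1)%:R).
have e0 k : 0 < e k.
  by rewrite mulr_gt0 ?invr_gt0 ?exprn_gt0// mul1r invr_gt0 ltr0n expn_gt0.
have [n_ [nS nk nle]] := subseq_cauchy e0 uC.
have [E [mE nE EB]] := @ae_cvg_subseq (fun k x => u (n_ k.+1) x - u (n_ k) x)
  (fun k => sqintB w0 mw (ui _) (ui _))
  (fun k => ltac:(by rewrite mulrC -ler_pdivlMr ?exprn_gt0// mulrC;
    exact: nle)).
(* Cutting off outside E makes the subsequence converge everywhere, hence to a measurable limit. *)
pose v k x := u (n_ k) x * \1_E x.
have mv k : measurable_fun [set: R] (v k).
  by apply: measurable_funM; [case: (ui (n_ k))|exact: measurable_indic].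
have cv x : cvgn (fun k => v k x).
  have [Ex|nEx] := pselect (E x).
    have [B xB] := EB x Ex.
    under eq_fun do rewrite /v indicE mem_set// mulr1.
    exact: cvg_of_sqr_summable xB.
  under eq_fun do rewrite /v indicE memNset// mulr0.
  exact: is_cvg_cst.
pose g x := limn (fun k => v k x).
have mg : measurable_fun [set: R] g by apply: measurable_fun_cvg mv _ => x _;
  exact: cv.
have key h r N : sqint w h ->
    (forall n, (N <= n)%N -> sqnorm w (fun x => u n x - h x) <= r) ->
    (\int[mu]_x ((g x - h x) ^+ 2 * w x)%:E <= r%:E)%E.
  move=> hi ur.
  have [mh _] := hi.
  pose G k x : \bar R := ((v k x - h x) ^+ 2 * w x)%:E.
  have G0 k x : (0 <= G k x)%E by rewrite lee_fin; apply: mulr_ge0;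
    [exact: sqr_ge0|exact: ltW].
  have mG k : measurable_fun [set: R] (G k).
    apply/measurable_EFinP; apply: measurable_funM => //.
    by apply: measurable_funX; exact: measurable_funB.
  have limG x : limn_einf (fun k => G k x) = ((g x - h x) ^+ 2 * w x)%:E.
    apply: (cvg_limn_einf_sup _).1; apply: cvg_EFin; first exact: nearW.
    apply: cvgM; last exact: cvg_cst.
    rewrite /=; apply: cvgM; (apply: cvgB; [exact: cv|exact: cvg_cst]).
  (* Fatou's lemma; the cut-off changes the integrals only on a negligible set. *)
  under eq_integral do rewrite -limG.
  apply: le_trans (fatou mu measurableT mG (fun k x _ => G0 k x)) _.
  apply: (@limn_einf_le _ _ N) => k Nk.
  have -> : (\int[mu]_x G k x = \int[mu]_x ((u (n_ k) x - h x) ^+ 2 * w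
    x)%:E)%E.
    apply: ge0_ae_eq_integral; [exact: measurableT|exact: mG| |by move=> x _;
      exact: G0| |].
    - apply/measurable_EFinP; apply: measurable_funM => //;
      apply: measurable_funX.
      exact: measurable_funB (ui (n_ k)).1 mh.
    - by move=> x _; rewrite lee_fin; apply: mulr_ge0;
      [exact: sqr_ge0|exact: ltW].
    - move: nE; apply: negligibleS => x /= nEx Ex; apply: nEx => _.
      by rewrite /G /v indicE mem_set// mulr1.
  rewrite (sqnormE (sqintB w0 mw (ui _) hi)) lee_fin.
  by apply: ur; exact: leq_trans (nk k).
have [N uN] := uC 1 ltr01.
have gi : sqint w g.
  (* Square integrability of g comes from g = (g - u N) + u N, where [key] bounds the first
     summand. *)
  have gu : sqint w (fun x => g x - u N x).
    apply: sqintP => //; first exact: measurable_funB mg (ui N).1.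
    apply: le_lt_trans (ltry 1); apply: (key _ _ N) => // n Nn.
    exact: uN.
  have := sqintD w0 mw gu (ui N); congr sqint.
  by apply/funext => x; rewrite subrK.
exists g; split => // h r M hi ur; rewrite -lee_fin -sqnormE//;
  last exact: sqintB.
exact: key hi ur.
Qed.

End riesz_fischer.

(** * Convergence of the shift *)

Section cauchy.
Context {R : realType}.
Notation mu := (@lebesgue_measure R).
Implicit Types (I J K : dyadic) (f g w : R -> R).

Lemma big_region_split (F : dyadic -> R) N0 N : (N0 <= N)%N ->
  \sum_(I <- undup (region N)) F I = \sum_(I <- undup (region N0)) F I +
    \sum_(I <- undup (region N) | I \notin region N0) F I.
Proof.
move=> N0N; rewrite (bigID (fun I => I \in region N0)); congr (_ + _).
rewrite -big_filter; apply: perm_big; apply: uniq_perm.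
- exact/filter_uniq/undup_uniq.
- exact: undup_uniq.
- move=> I; rewrite mem_filter !mem_undup; apply: andb_idr.
  exact: region_mono.
Qed.

Variables (w v : R -> R).
Hypotheses (w0 : forall x, 0 < w x) (wv : forall x, w x * v x = 1).
Hypotheses (mw : measurable_fun [set: R] w) (dw : dint w).
Hypothesis dv : dint v.
Variables (W beta : R) (p q : dyadic -> R).
Hypothesis wvW : forall I, avg w I * avg v I <= W.
Hypotheses (pb : forall I, `|p I| <= beta) (qb : forall I, `|q I| <= beta).

Notation S N f := (shift (undup (region N)) p q f).

Let signed N (t : dyadic -> R) f :=
  shift (undup (region N)) (fun I => t I * p I) (fun I => t I * q I) f.

(* A block of the series may be added with either sign to a signed partial sum
   of almost maximal norm; by the parallelogram law the block is small. *)
Lemma shift_cauchy f (e : R) : sqint w f -> 0 < e ->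
  exists N0, forall N, (N0 <= N)%N ->
    sqnorm w (fun x => S N f x - S N0 f x) <= e.
Proof.
move=> fi e0.
have si s t u g : sqint w (shift s t u g) by exact: sqint_shift.
pose A := [set y | exists N t, (forall I, `|t I| <= 1) /\
                   y = sqnorm w (signed N t f)].
(* Since |t I| <= 1 keeps the coefficients below [beta], one bound serves all signed sums. *)
have supA : has_sup A.
  split; first by exists (sqnorm w (signed 0 (fun=> 1) f)), 0%N, (fun=> 1);
    split => // I; rewrite normr1.
  exists ((3072 * W * beta) ^+ 2 * sqnorm w f) => _ [N [t [t1 ->]]].
  apply: (sqnorm_shift_le w0 wv mw dw dv wvW) => // I; rewrite normrM.
  - by rewrite -[beta]mul1r ler_pM.
  - by rewrite -[beta]mul1r ler_pM.
have [_ [N0 [t [t1 ->]]] near_sup] := sup_adherent e0 supA.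
exists N0 => N N0N.
set P := signed N0 t f in near_sup.
pose Y x := S N f x - S N0 f x.
(* P + s Y is again a signed sum, with factors t on [region N0] and s on the block outside it. *)
have comb s : `|s| <= 1 -> sqnorm w (fun x => P x + s * Y x) <= sup A.
  move=> s1; apply: ub_le_sup; first by case: supA.
  exists N, (fun I => if I \in region N0 then t I else s); split.
    by move=> I; case: ifP.
  congr sqnorm; apply/funext => x; rewrite /P /Y /signed /shift.
  rewrite !(big_region_split _ N0N) addrAC subrr add0r.
  congr (_ + _).
    rewrite !big_seq; apply: eq_bigr => I; rewrite mem_undup => ->.
    by [].
  rewrite mulr_sumr; apply: eq_bigr => I /negbTE ->.
  by ring.
have Yi : sqint w Y by exact: sqintB.
have := sqnorm_parallelogram w0 mw (si _ _ _ _ : sqint w P) Yi.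
have := comb 1; rewrite normr1 => /(_ (lexx _)).
have := comb (-1); rewrite normrN1 => /(_ (lexx _)).
under [X in sqnorm w X]eq_fun do rewrite mulN1r.
under [X in _ -> sqnorm w X <= _ -> _]eq_fun do rewrite mul1r.
(* In squared norms, 2 |P|^2 + 2 |Y|^2 <= 2 sup A and |P|^2 > sup A - e. *)
move: near_sup.
rewrite -/Y.
by lra.
Qed.

Lemma shift_cauchy2 f (e : R) : sqint w f -> 0 < e ->
  exists N0, forall n m, (N0 <= n)%N -> (N0 <= m)%N ->
    sqnorm w (fun x => S n f x - S m f x) <= e.
Proof.
move=> fi e0; have e40 : 0 < e / 4 by rewrite divr_gt0.
have [N0 PN] := shift_cauchy fi e40; exists N0 => n m /PN Pn /PN Pm.
have si s t u g : sqint w (shift s t u g) by exact: sqint_shift.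
have ni := sqintB w0 mw (si (undup (region n)) p q f) (si (undup (region N0)) p
  q f).
have mi := sqintB w0 mw (si (undup (region m)) p q f) (si (undup (region N0)) p
  q f).
have := sqnorm_parallelogram w0 mw ni mi.
have := sqnorm_ge0 w0 (fun x => S n f x - S N0 f x + (S m f x - S N0 f x)).
under [X in _ -> _ + sqnorm w X = _ -> _]eq_fun do rewrite opprB subrKA.
by move: Pn Pm; lra.
Qed.

(** The conclusion of [riesz_fischer], kept as the meaning of a limit of the partial sums. *)
Definition shift_lim_spec f g := sqint w g /\
  forall h e N, sqint w h ->
    (forall n, (N <= n)%N -> sqnorm w (fun x => S n f x - h x) <= e) ->
    sqnorm w (fun x => g x - h x) <= e.

Lemma shift_lim_exists f : sqint w f -> exists g, shift_lim_spec f g.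
Proof.
move=> fi; apply: (riesz_fischer w0 mw) => [n|e e0].
- exact: sqint_shift.
- exact: shift_cauchy2.
Qed.

Lemma shift_lim_norm f g : sqint w f -> shift_lim_spec f g ->
  sqnorm w g <= (3072 * W * beta) ^+ 2 * sqnorm w f.
Proof.
move=> fi [gi /(_ (fun=> 0) _ 0%N (sqint0 w)) H].
have E (h : R -> R) : (fun x => h x - 0) = h by apply/funext => x;
  rewrite subr0.
have := H ((3072 * W * beta) ^+ 2 * sqnorm w f); rewrite E.
apply=> n _; rewrite E.
exact: (sqnorm_shift_le w0 wv mw dw dv wvW).
Qed.

Lemma shift_lim_cvg f g (e : R) : sqint w f -> shift_lim_spec f g -> 0 < e ->
  exists N, forall n, (N <= n)%N -> sqnorm w (fun x => g x - S n f x) <= e.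
Proof.
move=> fi [gi H] e0; have [N PN] := shift_cauchy2 fi e0.
exists N => n Nn; apply: (H _ _ N); first exact: sqint_shift.
by move=> m Nm; exact: PN.
Qed.

Lemma sqnorm_eq0_ae f : sqint w f -> sqnorm w f = 0 ->
  {ae mu, forall x, f x = 0}.
Proof.
move=> fi f0; have [mf _] := fi.
have mF : measurable_fun [set: R] (fun x => (f x ^+ 2 * w x)%:E).
  apply/measurable_EFinP; apply: measurable_funM => //; exact: measurable_funX.
have := (ae_eq_integral_abs mu measurableT mF).1.
have E : (\int[mu]_x `|(f x ^+ 2 * w x)%:E| = 0)%E.
  rewrite -[RHS]/(0%:E) -f0 -sqnormE//; apply: eq_integral => x _.
  by rewrite gee0_abs// lee_fin; apply: mulr_ge0; [exact: sqr_ge0|exact: ltW].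
move=> /(_ E); apply: negligibleS => x /= nf H; apply: nf.
have [/eqP] := H Logic.I; rewrite mulf_eq0 (gt_eqF (w0 x)) orbF sqrf_eq0.
by move/eqP.
Qed.

Lemma shift_linear s (a : R) f g : dint f -> dint g ->
  shift s p q (fun y => a * f y + g y) =
  (fun x => a * shift s p q f x + shift s p q g x).
Proof.
move=> df dg; apply/funext => x; rewrite /shift mulr_sumr -big_split/=.
apply: eq_bigr => I _.
have dag : dint (fun y => a * f y + g y) by apply: dintD => //; exact: dintZ.
rewrite !pairing_haar// /hdiff !avgD ?avgZ//; try exact: dintZ.
by ring.
Qed.

Lemma ae_eq_of_sqnorm_small f : sqint w f ->
  (forall e : R, 0 < e -> sqnorm w f <= e) -> {ae mu, forall x, f x = 0}.
Proof.
move=> fi fe; apply: sqnorm_eq0_ae => //; apply/eqP.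
rewrite eq_le sqnorm_ge0// andbT.
by apply/ler_addgt0Pr => e e0; rewrite add0r fe.
Qed.

Lemma sqnormD_le f g : sqint w f -> sqint w g ->
  sqnorm w (fun x => f x + g x) <= 2 * sqnorm w f + 2 * sqnorm w g.
Proof.
move=> fi gi; have := sqnorm_parallelogram w0 mw fi gi.
by have := sqnorm_ge0 w0 (fun x => f x - g x); lra.
Qed.

(** Bookkeeping for [shift_lim_linear]: two uses of [sqnormD_le] turn three errors d into (6 + 4
    a^2) d. *)
Lemma error_split (a d e x1 x2 x3 y z : R) : x1 <= d -> x2 <= d -> x3 <= d ->
  y <= 2 * (a ^+ 2 * x1) + 2 * x2 -> z <= 2 * x3 + 2 * ((-1) ^+ 2 * y) ->
  d * (6 + 4 * a ^+ 2) = e -> z <= e.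
Proof.
move=> x1d x2d x3d yle zle <-.
have := ler_wpM2l (sqr_ge0 a) x1d.
by lra.
Qed.

Lemma shift_lim_linear (a : R) f g Tf Tg Th : sqint w f -> sqint w g ->
  shift_lim_spec f Tf -> shift_lim_spec g Tg ->
  shift_lim_spec (fun y => a * f y + g y) Th ->
  {ae mu, forall x, Th x = a * Tf x + Tg x}.
Proof.
move=> fi gi fT gT hT.
have hi : sqint w (fun y => a * f y + g y) by apply: sqintD => //;
  exact: sqintZ.
have [[Tfi _] [Tgi _] [Thi _]] := And3 fT gT hT.
pose D x := Th x - (a * Tf x + Tg x).
have Di : sqint w D.
  by apply: sqintB => //; apply: sqintD => //; exact: sqintZ.
suff : {ae mu, forall x, D x = 0}.
  by apply: negligibleS => x /= nE /eqP; rewrite subr_eq0 => /eqP.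
apply: ae_eq_of_sqnorm_small => // e e0.
have a2 : 0 <= a ^+ 2 := sqr_ge0 a.
pose d := e / (6 + 4 * a ^+ 2).
have den0 : 0 < 6 + 4 * a ^+ 2 by lra.
have d0 : 0 < d by rewrite divr_gt0.
have [N1 P1] := shift_lim_cvg fi fT d0.
have [N2 P2] := shift_lim_cvg gi gT d0.
have [N3 P3] := shift_lim_cvg hi hT d0.
pose n := maxn N1 (maxn N2 N3).
have {}P1 := P1 n (leq_maxl _ _).
have {}P2 := P2 n (leq_trans (leq_maxl _ _) (leq_maxr _ _)).
have {}P3 := P3 n (leq_trans (leq_maxr _ _) (leq_maxr _ _)).
have Si g' : sqint w (S n g') by exact: sqint_shift.
have i1 := sqintB w0 mw Tfi (Si f).
have i2 := sqintB w0 mw Tgi (Si g).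
have i3 := sqintB w0 mw Thi (Si (fun y => a * f y + g y)).
(* Finite shifts are exactly linear, so the defect D is a combination of three approximation
   errors. *)
have -> : D = (fun x => (Th x - S n (fun y => a * f y + g y) x) +
   (-1) * (a * (Tf x - S n f x) + (Tg x - S n g x))).
  apply/funext => x.
  rewrite (shift_linear _ _ (sqint_dint w0 wv dv fi) (sqint_dint w0 wv dv gi)).
  by rewrite /D; ring.
have i4 := sqintD w0 mw (sqintZ w0 mw a i1) i2.
have H1 := sqnormD_le i3 (sqintZ w0 mw (-1) i4).
have H2 := sqnormD_le (sqintZ w0 mw a i1) i2.
rewrite sqnormZ// in H1; rewrite sqnormZ// in H2.
have dE : d * (6 + 4 * a ^+ 2) = e by rewrite /d divfK// gt_eqF.
exact: error_split P1 P2 P3 H2 H1 dE.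
Qed.

End cauchy.

(** * The commutator *)

Section haar_combinations.
Context {R : realType}.
Notation mu := (@lebesgue_measure R).
Implicit Types (r : seq (R * dyadic)) (b f : R -> R).

(** Lists of pairs may repeat an interval, so [dshift] and [lambda] act on them without merging
    coefficients. *)
Definition comb r (x : R) : R := \sum_(z <- r) z.1 * haar z.2 x.

Lemma haar_comb_comb f : haar_comb f -> exists r, f = comb r.
Proof.
move=> [s [c ->]]; exists [seq (c i, i) | i <- s].
by apply/funext => x; rewrite /comb big_map.
Qed.

Lemma pairing_comb r J :
  pairing (comb r) (haar J) = \sum_(z <- r) z.1 * (z.2 == J)%:R.
Proof.
elim: r => [|z r IH].
  rewrite big_nil /pairing /comb.
  by under eq_Rintegral do rewrite big_nil mul0r; rewrite Rintegral_cst ?mul0r.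
have dr : dint (comb r).
  elim: r {IH} => [|y r IH].
    suff -> : comb [::] = fun=> 0 by exact: dint_cst.
    by apply/funext => x; rewrite /comb big_nil.
  suff -> : comb (y :: r) = fun x => y.1 * haar y.2 x + comb r x.
    by apply: dintD => //; apply: dintZ; exact: dint_haar.
  by apply/funext => x; rewrite /comb big_cons.
rewrite big_cons -IH /pairing.
have E x : comb (z :: r) x * haar J x =
    z.1 * (haar z.2 x * haar J x) + comb r x * haar J x.
  by rewrite /comb big_cons; ring.
under eq_Rintegral do rewrite E.
have i1 := integrable_mul_haar J (dint_haar z.2).
have i2 := integrable_mul_haar J dr.
rewrite RintegralD//; last exact: integrable_EFinZ.
by rewrite RintegralZl// -haar_orthonormal.
Qed.

Lemma sum_pairing_comb r (G : dyadic -> R) (s : seq dyadic) :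
  uniq s -> {subset [seq z.2 | z <- r] <= s} ->
  \sum_(J <- s) pairing (comb r) (haar J) * G J = \sum_(z <- r) z.1 * G z.2.
Proof.
move=> us rs; under eq_bigr do rewrite pairing_comb mulr_suml.
rewrite exchange_big/= !big_seq; apply: eq_bigr => z zr.
rewrite (bigD1_seq z.2)//=; last by apply: rs; exact: map_f.
by rewrite eqxx mulr1 big1 ?addr0// => J /negbTE; rewrite eq_sym => ->;
  rewrite mulr0 mul0r.
Qed.

Lemma fsum_pairing_comb r (G : dyadic -> R) :
  \sum_(J \in [set: dyadic]) pairing (comb r) (haar J) * G J =
  \sum_(z <- r) z.1 * G z.2.
Proof.
have us := undup_uniq [seq z.2 | z <- r].
(* Only intervals occurring in r can have nonzero coefficients. *)
rewrite -(@fsbig_widen _ _ _ _ [set` undup [seq z.2 | z <- r]])//; last first.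
  move=> J [_ /= nJ]; rewrite pairing_comb big_seq big1 ?mul0r// => z zr.
  have [zJ|_] := eqVneq z.2 J; last by rewrite mulr0.
  by exfalso; apply: nJ; rewrite mem_undup -zJ map_f.
rewrite -fsbig_seq//; apply: sum_pairing_comb => // J.
by rewrite mem_undup.
Qed.

Lemma dshift_comb r : dshift (comb r) =
  comb (flatten [seq [:: (z.1, lhalf z.2); (- z.1, rhalf z.2)] | z <- r]).
Proof.
apply/funext => x; rewrite /dshift fsum_pairing_comb /comb big_flatten big_map.
by apply: eq_bigr => z _; rewrite !big_cons big_nil /=; ring.
Qed.

Lemma lambda_comb b r :
  lambda b (comb r) = comb [seq (z.1 * avg b z.2, z.2) | z <- r].
Proof.
apply/funext => x; rewrite /lambda /comb big_map.
under eq_fsbigr do rewrite [avg b _ * _]mulrC -mulrA.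
rewrite (fsum_pairing_comb r (fun J => avg b J * haar J x)).
by apply: eq_bigr => z _ /=; rewrite mulrA.
Qed.

(** On h_I, lambda_b S gives <b>_(I-) h_(I-) - <b>_(I+) h_(I+), and S lambda_b gives <b>_I (h_(I-) -
    h_(I+)). *)
Lemma commutator_comb b r N : {subset [seq z.2 | z <- r] <= region N} ->
  commutator b (comb r) = shift (undup (region N))
    (fun I => avg b (lhalf I) - avg b I) (fun I => avg b I - avg b (rhalf I))
    (comb r).
Proof.
move=> rN; apply/funext => x; rewrite /shift.
rewrite (sum_pairing_comb (fun I =>
  (avg b (lhalf I) - avg b I) * haar (lhalf I) x +
   (avg b I - avg b (rhalf I)) * haar (rhalf I) x)); last 2 first.
- exact: undup_uniq.
- by move=> J /rN; rewrite mem_undup.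
rewrite /commutator dshift_comb !lambda_comb dshift_comb /comb.
rewrite !big_map big_flatten big_map -map_comp big_flatten big_map -sumrB.
by apply: eq_bigr => z _; rewrite !big_cons !big_nil/=; ring.
Qed.

End haar_combinations.

(** * BMO bounds for the coefficients of the commutator *)

Section bmo.
Context {R : realType}.
Implicit Types (b : R -> R) (I : dyadic).

Lemma eavgE (f : R -> R) I : dint f -> eavg f I = (avg f I)%:E.
Proof.
move=> df; rewrite /avg fineK// /eavg fin_numM//.
by apply: integrable_fin_num; [exact: measurable_dset|exact: df].
Qed.

(** For a half J of I, |<b>_J - <b>_I| is at most the mean of |b - <b>_I| over J, hence at most
    twice its mean over I. *)
Lemma bmo_norm_fin b : BMOd b ->
  exists2 B : R, 0 <= B & bmo_norm b = B%:E /\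
    forall I, `|avg b (lhalf I) - avg b I| <= 2 * B /\
              `|avg b I - avg b (rhalf I)| <= 2 * B.
Proof.
move=> [lb bfin]; have db := locally_integrable_dint lb.
have dbI I : dint (fun x => b x - avg b I) by apply: dintD => //;
  exact: dint_cst.
have osc I : ((avg (fun x => `|b x - avg b I|) I)%:E <= bmo_norm b)%E.
  rewrite -eavgE; last exact: dint_norm.
  by apply: ereal_sup_ubound; exists I.
have osc0 J I : 0 <= avg (fun x => `|b x - avg b I|) J.
  by apply: avg_ge0 => //; exact: dint_norm.
have b0 : (0 <= bmo_norm b)%E.
  by apply: le_trans (osc (0, 0)); rewrite lee_fin.
have bE : bmo_norm b = (fine (bmo_norm b))%:E by rewrite fineK// ge0_fin_numE.
exists (fine (bmo_norm b)); first exact: fine_ge0.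
split=> // I.
have oscI : avg (fun x => `|b x - avg b I|) I <= fine (bmo_norm b).
  by rewrite -lee_fin -bE.
have half J : avg (fun x => `|b x - avg b I|) J <= 2 * fine (bmo_norm b) ->
    `|avg b J - avg b I| <= 2 * fine (bmo_norm b).
  apply: le_trans.
  have -> : avg b J - avg b I = avg (fun x => b x - avg b I) J.
    by rewrite avgD ?avg_cst//; exact: dint_cst.
  exact: avg_norm.
have := avg_martingale (dint_norm (dbI I)) I.
have := osc0 (lhalf I) I; have := osc0 (rhalf I) I => r0 l0 m.
split; first by apply: half; lra.
by rewrite distrC; apply: half; lra.
Qed.

End bmo.

(** * Everywhere positive representatives of weights *)

Section weights.
Context {R : realType}.
Notation mu := (@lebesgue_measure R).
Implicit Types (w f : R -> R) (I : dyadic).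

(** 1/f = f (f^2)^(-1) reduces to a power of a nonnegative function; where f = 0 both sides are 0 by
    convention. *)
Lemma measurable_fun_inv f : measurable_fun [set: R] f ->
  measurable_fun [set: R] (fun x => (f x)^-1).
Proof.
move=> mf.
have -> : (fun x => (f x)^-1) = (fun x => f x * (f x ^+ 2) `^ (-1)).
  apply/funext => x; rewrite powR_inv1 ?sqr_ge0// expr2 invfM mulrA.
  have [->|f0] := eqVneq (f x) 0; first by rewrite mul0r invr0 mul0r.
  by rewrite divff// mul1r.
apply: measurable_funM => //.
apply: (measurableT_comp (measurable_powR (-1))).
exact: measurable_funX.
Qed.

(** A weight is positive only almost everywhere; this version has w v = 1 at every point and the
    same integrals. *)
Definition pos_repr w (x : R) : R := if 0 < w x then w x else 1.

Lemma pos_repr_gt0 w x : 0 < pos_repr w x.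
Proof. by rewrite /pos_repr; case: ifP. Qed.

Lemma measurable_pos_repr w : measurable_fun [set: R] w ->
  measurable_fun [set: R] (pos_repr w).
Proof.
move=> mw; apply: measurable_fun_ifT => //.
by apply: measurable_fun_ltr => //; exact: measurable_cst.
Qed.

Lemma ae_integral_pos_repr w (F G : R -> \bar R) (D : set (measurableTypeR R)) :
  weight w -> measurable D -> measurable_fun D F -> measurable_fun D G ->
  (forall x, 0 < w x -> F x = G x) ->
  (\int[mu]_(x in D) F x = \int[mu]_(x in D) G x)%E.
Proof.
move=> [_ wpos] mD mF mG FG; apply: ae_eq_integral => //.
by apply: negligibleS wpos => x /= H wx; apply: H => _; exact: FG.
Qed.

Lemma A2_dual w : A2d w ->
  let w' := pos_repr w in let v := fun x => (w' x)^-1 in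
  exists2 W : R, A2_char w = W%:E &
    [/\ dint w', dint v & forall I, avg w' I * avg v I <= W].
Proof.
move=> [wt wfin] w' v; have [lw wpos] := wt.
have [mw _ _] := lw; have dw0 := locally_integrable_dint lw.
have mw' := measurable_pos_repr mw; have mv := measurable_fun_inv mw'.
have mw1 := measurable_fun_inv mw.
have w'E x : 0 < w x -> w' x = w x by rewrite /w' /pos_repr => ->.
have v0 x : 0 <= v x by rewrite invr_ge0 ltW// pos_repr_gt0.
have dw : dint w'.
  move=> I; apply/integrableP; split.
    by apply/measurable_EFinP; exact: measurable_funTS.
  have /integrableP[_] := dw0 I; congr (_ < _)%E.
  apply: (ae_integral_pos_repr wt) => //.
  - exact: measurable_dset.
  - by apply: measurableT_comp => //; apply/measurable_EFinP;
    exact: measurable_funTS.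
  - by apply: measurableT_comp => //; apply/measurable_EFinP;
    exact: measurable_funTS.
  - by move=> x wx; rewrite /= w'E.
have ew I : eavg w I = eavg w' I.
  congr (_ * _)%E; apply: (ae_integral_pos_repr wt).
  - exact: measurable_dset.
  - by apply/measurable_EFinP; exact: measurable_funTS.
  - by apply/measurable_EFinP; exact: measurable_funTS.
  - by move=> x wx; rewrite w'E.
have ev I : eavg (fun x => (w x)^-1) I = eavg v I.
  congr (_ * _)%E; apply: (ae_integral_pos_repr wt).
  - exact: measurable_dset.
  - by apply/measurable_EFinP; exact: measurable_funTS.
  - by apply/measurable_EFinP; exact: measurable_funTS.
  - by move=> x wx; rewrite /v w'E.
have A2I I : (eavg w' I * eavg v I <= A2_char w)%E.
  by rewrite -ew -ev; apply: ereal_sup_ubound; exists I.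
have int0 I : (0 <= \int[mu]_(x in dset I) (v x)%:E)%E.
  by apply: integral_ge0 => x _; rewrite lee_fin.
have ev0 I : (0 <= eavg v I)%E.
  by rewrite mule_ge0// lee_fin invr_ge0 ltW// dlen_gt0.
(* [avg_weight_gt0] presupposes [dint v], so positivity is shown directly: a zero mean would make w'
   vanish almost everywhere on I. *)
have w'I I : 0 < avg w' I.
  rewrite lt_neqAle eq_sym avg_ge0 ?andbT//; last by move=> x;
    exact/ltW/pos_repr_gt0.
  apply/negP => /eqP w'0.
  have : (\int[mu]_(x in dset I) `|(w' x)%:E| = 0)%E.
    under eq_integral do rewrite gee0_abs ?lee_fin ?(ltW (pos_repr_gt0 _ _))//.
    have := Rintegral_dset I dw; rewrite w'0 mulr0 /Rintegral => i0.
    rewrite -[LHS]fineK ?i0//.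
    by apply: integrable_fin_num; [exact: measurable_dset|exact: dw].
  move=> /(ae_eq_integral_abs mu (measurable_dset I) _).1 -/(_ _) [].
    by apply/measurable_EFinP; exact: measurable_funTS.
  move=> N [mN N0 sub].
  have : (mu (dset I) <= mu N)%E.
    apply: le_measure; rewrite ?inE//; first exact: measurable_dset.
    move=> x Ix; apply: sub => /= /(_ Ix) [w'x].
    by have := pos_repr_gt0 w x; rewrite -/(w' x) w'x ltxx.
  rewrite [X in (_ <= X)%E]N0 lebesgue_measure_dset lee_fin.
  by rewrite leNgt dlen_gt0.
(* An infinite mean of v times the positive mean of w' would make the A_2 characteristic
   infinite. *)
have vfin I : (eavg v I < +oo)%E.
  rewrite ltey; apply/eqP => vy.
  have := A2I I; rewrite vy eavgE// gt0_muley ?lte_fin// leye_eq => /eqP A2y.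
  by rewrite A2y ltxx in wfin.
have dv : dint v.
  move=> I; apply/integrableP; split.
    by apply/measurable_EFinP; exact: measurable_funTS.
  under eq_integral do rewrite gee0_abs ?lee_fin//.
  rewrite ltey; apply/eqP => vy; have := vfin I.
  by rewrite /eavg vy gt0_muley ?ltxx// lte_fin invr_gt0 dlen_gt0.
have A20 : (0 <= A2_char w)%E.
  apply: le_trans (A2I (0, 0)); rewrite mule_ge0// eavgE// lee_fin ltW//.
have AE : A2_char w = (fine (A2_char w))%:E by rewrite fineK// ge0_fin_numE.
exists (fine (A2_char w)) => //; split=> // I.
by rewrite -lee_fin -AE EFinM -!eavgE.
Qed.

Lemma L2normE w f : weight w -> measurable_fun [set: R] f ->
  L2norm w f = sqrte (\int[mu]_x (f x ^+ 2 * pos_repr w x)%:E)%E.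
Proof.
move=> wt mf; have [[mw _ _] _] := wt; congr sqrte.
apply: (ae_integral_pos_repr wt) => //.
- apply/measurable_EFinP; apply: measurable_funM => //; apply: measurable_funX.
  exact: measurableT_comp.
- apply/measurable_EFinP; apply: measurable_funM; first exact: measurable_funX.
  exact: measurable_pos_repr.
- by move=> x wx; rewrite /pos_repr wx real_normK// num_real.
Qed.

Lemma L2norm_sqnorm w f : weight w -> sqint (pos_repr w) f ->
  L2norm w f = (Num.sqrt (sqnorm (pos_repr w) f))%:E.
Proof. by move=> wt fi; rewrite L2normE//; [rewrite sqnormE|case: fi]. Qed.

Lemma L2P w f : weight w -> L2 w f <-> sqint (pos_repr w) f.
Proof.
move=> wt; have [[mw _ _] _] := wt; split=> [[mf]|fi]; last first.
  by split; [case: fi|rewrite L2norm_sqnorm// ltry].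
rewrite L2normE// => foo; apply: sqintP => //.
- by move=> x; exact: pos_repr_gt0.
- exact: measurable_pos_repr.
by move: foo; case: (integral _ _ _) => [r _|//|//]; rewrite ltry.
Qed.

End weights.

(** * The bounded extension of the commutator *)

Theorem theorem1p2 (R : realType) :
  exists C : R, 0 < C /\
    forall b w : R -> R, BMOd b -> A2d w ->
      exists T : (R -> R) -> (R -> R),
        bounded_extension w (commutator b) T /\
        (opnorm w T <= C%:E * A2_char w * bmo_norm b)%E.
Proof.
(* 3072 comes from [sqnorm_shift_le], and the factor 2 from the bound 2 B on p and q. *)
exists 6144; split; first by rewrite ltr0n.
move=> b w bB wA.
have [B B0 [bE pq]] := bmo_norm_fin bB.
have [W WE [dw dv wvW]] := A2_dual wA.
have wt : weight w by case: wA.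
have mw : measurable_fun [set: R] (pos_repr w).
  by apply: measurable_pos_repr; case: wt => -[].
have w0 := pos_repr_gt0 w.
have wv x : pos_repr w x * (pos_repr w x)^-1 = 1 by rewrite divff// gt_eqF.
pose p I := avg b (lhalf I) - avg b I.
pose q I := avg b I - avg b (rhalf I).
have pb I : `|p I| <= 2 * B by case: (pq I).
have qb I : `|q I| <= 2 * B by case: (pq I).
pose spec := shift_lim_spec (pos_repr w) p q.
have ex f : exists g, sqint (pos_repr w) f -> spec f g.
  (* Outside L^2(w) nothing is asked of T f; f is a dummy witness. *)
  have [fi|nf] := pselect (sqint (pos_repr w) f); last by exists f.
  by have [g gP] := shift_lim_exists w0 wv mw dw dv wvW pb qb fi; exists g.
have [T TP] := choice ex.
have W0 : 0 <= W.
  apply: le_trans (wvW (0, 0)); apply: mulr_ge0; apply: avg_ge0 => // x.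
    exact: ltW.
  by rewrite invr_ge0 ltW.
pose K : R := 3072 * W * (2 * B).
have K0 : 0 <= K by exact: mulr_ge0 (mulr_ge0 (ler0n _ _) W0) (mulr_ge0 (ler0n
  _ _) B0).
have op : (opnorm w T <= K%:E)%E.
  apply: ge_ereal_sup => _ [f [/(L2P _ wt) fi f1] <-].
  have gP := TP f fi.
  rewrite L2norm_sqnorm// in f1; rewrite L2norm_sqnorm; [|by []|by case: gP].
  rewrite lee_fin in f1; rewrite lee_fin.
  have N := shift_lim_norm w0 wv mw dw dv wvW pb qb fi gP.
  apply: le_trans (_ : Num.sqrt (K ^+ 2 * sqnorm (pos_repr w) f) <= _).
    by rewrite ler_wsqrtr.
  by rewrite sqrtrM ?sqr_ge0// sqrtr_sqr ger0_norm// ler_piMr.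
exists T; split; last first.
  apply: le_trans op _; rewrite WE bE -!EFinM lee_fin.
  by rewrite le_eqVlt; apply/orP; left; apply/eqP; rewrite /K; ring.
split.
- by move=> f /(L2P _ wt) fi; apply/(L2P _ wt); case: (TP f fi).
- move=> a f g /(L2P _ wt) fi /(L2P _ wt) gi.
  have hi : sqint (pos_repr w) (fun y => a * f y + g y).
    by apply: sqintD => //; exact: sqintZ.
  exact: (shift_lim_linear w0 wv mw dw dv wvW pb qb fi gi (TP _ fi) (TP _ gi)
    (TP _ hi)).
- exact: le_lt_trans op (ltry _).
- move=> f /haar_comb_comb[r ->].
  have ri : sqint (pos_repr w) (comb r).
    rewrite /comb; elim: r => [|z r IH].
      by under eq_fun do rewrite big_nil; exact: sqint0.
    under eq_fun do rewrite big_cons.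
    by apply: sqintD => //; apply: sqintZ => //; exact: sqint_haar.
  have [N rN] := region_seq [seq z.2 | z <- r].
  have Ei : sqint (pos_repr w) (commutator b (comb r)).
    by rewrite (commutator_comb _ rN); exact: sqint_shift.
  have Di := sqintB w0 mw (TP _ ri).1 Ei.
  suff : {ae lebesgue_measure, forall x,
    T (comb r) x - commutator b (comb r) x = 0}.
    by apply: negligibleS => x /= nE /eqP; rewrite subr_eq0 => /eqP.
  apply: (ae_eq_of_sqnorm_small w0 mw Di) => e e0.
  (* Over any region containing the intervals of r the shift equals the commutator, and over large
     regions it is within e of T. *)
  have [M MP] := shift_lim_cvg w0 wv mw dw dv wvW pb qb ri (TP _ ri) e0.
  have rM : {subset [seq z.2 | z <- r] <= region (maxn N M)}.
    by move=> J /rN; apply: region_mono; exact: leq_maxl.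
  by rewrite (commutator_comb _ rM); apply: MP; exact: leq_maxr.
Qed.
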